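(* For every fixed integer $k\ge 2$, $k\textsc{-Polygon-Circle-Recognition}$ belongs to $\mathsf{dMAM}[\log n]$: there is a three-interaction (Merlin–Arthur–Merlin) distributed interactive protocol with certificates and messages of $\mathcal{O}(\log n)$ bits that decides whether the connected $n$-node network $G$ is a $k$-polygon-circle graph, with completeness and soundness error at most $1/3$.
   Context: A $k$-polygon-circle graph is the intersection graph of a family of convex polygons with $k$ vertices, all vertices lying on a common circle. $k\textsc{-Polygon-Circle-Recognition}$ is the set of configurations $\langle G,\mathrm{id}\rangle$ with $G$ a $k$-polygon-circle graph. Distributed setting: $G=(V,E)$ is a simple connected $n$-node graph, each node has a unique identifier in $\{1,\dots,\mathrm{poly}(n)\}$, nodes know only a polynomial upper bound on $n$. A $\mathsf{dMAM}[f(n)]$ protocol: an untrusted, computationally unbounded prover (Merlin) who knows the whole configuration gives each node a certificate; then a public random string $r$ shared by all nodes (and seen by Merlin) is drawn; then Merlin gives each node a second certificate depending on $r$; finally, in one deterministic round each node sends one message to each neighbor (depending on its id, input, $r$ and certificates) and accepts or rejects. Certificates and messages have $\mathcal{O}(f(n))$ bits. Completeness: if $G$ is in the class, some prover makes all nodes accept with probability $\ge 2/3$. Soundness: if not, for every prover some node rejects with probability $\ge 2/3$. *)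

(* Defs.v *)
From HB Require Import structures.
From mathcomp Require Import all_boot all_order all_algebra.
From mathcomp Require Import Rstruct.
From Stdlib Require Import Rdefinitions.

Set Implicit Arguments.
Unset Strict Implicit.
Unset Printing Implicit Defensive.

Import Order.TTheory GRing.Theory Num.Theory.

Local Open Scope ring_scope.

Definition point := (R * R)%type.

Definition on_circle (c : point) (rho : R) (q : point) : Prop :=
  (q.1 - c.1) ^+ 2 + (q.2 - c.2) ^+ 2 = rho ^+ 2.

Definition in_hull (k : nat) (p : 'I_k -> point) (x : point) : Prop :=
  exists w : 'I_k -> R,
    (forall i, 0 <= w i) /\ \sum_(i < k) w i = 1 /\
    x.1 = \sum_(i < k) w i * (p i).1 /\ x.2 = \sum_(i < k) w i * (p i).2.

Definition k_polygon_circle (k n : nat) (e : rel 'I_n) : Prop :=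
  exists (c : point) (rho : R) (P : 'I_n -> 'I_k -> point),
    0 < rho /\
    (forall v, injective (P v)) /\
    (forall v i, on_circle c rho (P v i)) /\
    (forall u v, u != v ->
       (e u v <-> exists x, in_hull (P u) x /\ in_hull (P v) x)).

Local Close Scope ring_scope.

Definition simple_connected (n : nat) (e : rel 'I_n) : Prop :=
  symmetric e /\ irreflexive e /\ (forall u v, connect e u v).

Definition valid_ids (n d : nat) (id : 'I_n -> nat) : Prop :=
  injective id /\ (forall v, 1 <= id v <= n ^ d).

Definition bits := seq bool.

(* A dMAM verifier.  All local functions receive the known upper bound N
   on n, the node's identifier, the public random string r, and the
   node's first and second certificates.
   - rlen N : length of the public random string (uniform in {0,1}^(rlen N));
   - msg    : the message the node sends to its neighbours;
   - dec    : the node's decision, also given the list of messages received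
              from its neighbours (listed in increasing order of the senders'
              identifiers). *)
Record dMAM_protocol := DMAM {
  rlen : nat -> nat;
  msg  : nat -> nat -> bits -> bits -> bits -> bits;
  dec  : nat -> nat -> bits -> bits -> bits -> seq bits -> bool
}.

Definition neighbours_by_id (n : nat) (e : rel 'I_n) (id : 'I_n -> nat)
  (v : 'I_n) : seq 'I_n :=
  sort (fun a b => id a <= id b) [seq u <- enum 'I_n | e v u].

Definition all_accept (P : dMAM_protocol) (n : nat) (e : rel 'I_n)
  (id : 'I_n -> nat) (N : nat) (r : bits) (c1 c2 : 'I_n -> bits) : bool :=
  [forall v : 'I_n,
     dec P N (id v) r (c1 v) (c2 v)
       [seq msg P N (id u) r (c1 u) (c2 u) | u <- neighbours_by_id e id v]].

Definition certs_bounded (n : nat) (B : nat) (c : 'I_n -> bits) : Prop :=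
  forall v, size (c v) <= B.

Definition n_accepting (P : dMAM_protocol) (n : nat) (e : rel 'I_n)
  (id : 'I_n -> nat) (N : nat) (c1 : 'I_n -> bits)
  (c2 : bits -> 'I_n -> bits) : nat :=
  #|[set r : (rlen P N).-tuple bool | all_accept P e id N (val r) c1 (c2 (val r))]|.

(* Main.v *)
(** Each polygon is a set of [k] slots on a cyclic order cut into a line, and two
    polygons intersect iff their slots interleave.  Merlin gives every node its
    sorted slots and, for each slot, the number of leading slots (smallest slots
    of polygons) before it.  Nodes check that their neighbours' slots interleave
    with theirs, and that in every gap between two consecutive slots the
    non-neighbours have [k] times as many slots as leading slots; both numbers
    are computable from the labels of the node and its neighbours.  If some
    non-neighbouring pair crossed, a pair whose later polygon starts earliest
    would violate this equation.

    The slots and labels are globally consistent iff the multiset of states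
    [(slot, label)] equals, up to the end points, the multiset of successor
    states.  This is tested by comparing sums of a random hash over the two
    multisets, aggregated along parent pointers; a parent relation with at most
    one root suffices for this and need not be checked to be acyclic. *)

From Stdlib Require Import Rdefinitions.
Require Import Defs.
From HB Require Import structures.
From mathcomp Require Import all_boot all_order all_algebra.
From mathcomp Require Import Rstruct zify ring.

Set Implicit Arguments.
Unset Strict Implicit.
Unset Printing Implicit Defensive.

(** * Interleaving and polygons inscribed in a circle *)

(** The obstacle is non-adjacency: a node sees no certificate of a non-neighbour, so a forbidden
    crossing can only be noticed by counting. A polygon that does not cross [v] lies inside one gap
    of [v], bringing all its [k] slots together with its leading one, or outside all gaps; this is
    where the factor [k] comes from. Crossing polygons may cause errors of both signs, which could
    cancel; the extremal pair is chosen so that in the gap concerned every other non-neighbour errs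
    in one direction only. Labels turn the number of leading slots in a gap, a global quantity, into
    a difference of two local numbers.

    Slots and labels are fixed before the random string is drawn, so the two multisets compared do
    not depend on it. Only certificates and messages are charged, so the string may be a whole table
    of independent two-bit values, one per possible state. Distinct multisets then collide with
    probability at most 1/4, below the allowed 1/3, and the sums stay polynomial without any modular
    arithmetic.

    Polygons may share vertices while slots must be distinct, so coinciding vertices have to be
    split without losing an intersection. *)

Definition interleave (T : Type) (lt : rel T) (s t : seq T) : bool :=
  has (fun a => has (fun b => has (fun c => has (fun d =>
    [&& lt a b, lt b c & lt c d]) t) s) t) s.

(** Only cyclic alternation matters on a circle; once the circle is cut, an alternating quadruple
    may begin with either set. *)
Definition meets (T : Type) (lt : rel T) (s t : seq T) : bool :=
  interleave lt s t || interleave lt t s.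

Lemma interleaveP (T : eqType) (lt : rel T) (s t : seq T) :
  reflect (exists a b c d, [/\ a \in s, b \in t, c \in s & d \in t] /\
             [/\ lt a b, lt b c & lt c d])
          (interleave lt s t).
Proof.
apply: (iffP hasP) => [[a sa /hasP[b tb /hasP[c sc /hasP[d td /and3P[*]]]]]|].
  by exists a, b, c, d.
move=> [a [b [c [d [[sa tb sc td] [ab bc cd]]]]]].
exists a => //; apply/hasP; exists b => //; apply/hasP; exists c => //.
by apply/hasP; exists d => //; apply/and3P.
Qed.

Lemma meetsC (T : Type) (lt : rel T) (s t : seq T) :
  meets lt s t = meets lt t s.
Proof. by rewrite /meets orbC. Qed.

Lemma eq_mem_meets (T : eqType) (lt : rel T) (s s' t t' : seq T) :
  s =i s' -> t =i t' -> meets lt s t = meets lt s' t'.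
Proof.
have H (s1 s2 t1 t2 : seq T) : s1 =i s2 -> t1 =i t2 ->
    interleave lt s1 t1 -> interleave lt s2 t2.
  move=> es et /interleaveP[a [b [c [d [[sa tb sc td] lts]]]]].
  by apply/interleaveP; exists a, b, c, d; rewrite -!es -!et.
have E (s1 s2 t1 t2 : seq T) : s1 =i s2 -> t1 =i t2 ->
    interleave lt s1 t1 = interleave lt s2 t2.
  by move=> es et; apply/idP/idP; apply: H => // x; rewrite ?es ?et.
by move=> es et; rewrite /meets (E s s' t t') // (E t t' s s').
Qed.

(** * Intersecting hulls of points on a circle *)

Section Circle.
Import Order.TTheory GRing.Theory Num.Theory.
Local Open Scope ring_scope.

Lemma hull_affine_ge0 (k : nat) (p : 'I_k -> point) (x : point) (al be ga : R) :
  in_hull p x -> (forall i, 0 <= al + be * (p i).1 + ga * (p i).2) ->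
  0 <= al + be * x.1 + ga * x.2.
Proof.
move=> [w [w0 [w1 [-> ->]]]] p0.
suff -> : al + be * (\sum_(i < k) w i * (p i).1) + ga * (\sum_(i < k) w i * (p i).2)
  = \sum_(i < k) w i * (al + be * (p i).1 + ga * (p i).2).
  by apply: sumr_ge0 => i _; apply: mulr_ge0.
rewrite -[al in LHS]mulr1 -w1 !mulr_sumr -!big_split /=.
by apply: eq_bigr => i _; ring.
Qed.

Lemma hull_affine_gt0 (k : nat) (p : 'I_k -> point) (x : point) (al be ga : R) :
  in_hull p x -> (forall i, 0 < al + be * (p i).1 + ga * (p i).2) ->
  0 < al + be * x.1 + ga * x.2.
Proof.
move=> [w [w0 [w1 [-> ->]]]] p0.
have -> : al + be * (\sum_(i < k) w i * (p i).1) + ga * (\sum_(i < k) w i * (p i).2)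
  = \sum_(i < k) w i * (al + be * (p i).1 + ga * (p i).2).
  rewrite -[al in LHS]mulr1 -w1 !mulr_sumr -!big_split /=.
  by apply: eq_bigr => i _; ring.
have F0 i : true -> 0 <= w i * (al + be * (p i).1 + ga * (p i).2).
  by move=> _; rewrite mulr_ge0 // ltW.
rewrite lt0r sumr_ge0 // andbT; apply/negP; rewrite psumr_eq0 // => /allP wA0.
move/eqP: w1; rewrite big1 ?(eq_sym 0) ?oner_eq0 // => i _.
have := wA0 i; rewrite mem_index_enum => /(_ isT) /=.
by rewrite mulf_eq0 (gt_eqF (p0 i)) orbF => /eqP.
Qed.

Lemma hull_vertex (k : nat) (p : 'I_k -> point) (i : 'I_k) : in_hull p (p i).
Proof.
have D (f : 'I_k -> R) : \sum_(j < k) (j == i)%:R * f j = f i.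
  rewrite (bigD1 i) //= eqxx mul1r big1 ?addr0 // => j /negPf ->.
  by rewrite mul0r.
exists (fun j => (j == i)%:R); do !split; rewrite ?D //.
by under eq_bigr do rewrite -[_%:R]mulr1; rewrite (D (fun=> 1)).
Qed.

Lemma hull_convex (k : nat) (p : 'I_k -> point) (x y : point) (a b : R) :
  0 <= a -> 0 <= b -> a + b = 1 -> in_hull p x -> in_hull p y ->
  in_hull p (a * x.1 + b * y.1, a * x.2 + b * y.2).
Proof.
move=> a0 b0 ab [w [w0 [w1 [-> ->]]]] [z [z0 [z1 [-> ->]]]].
exists (fun i => a * w i + b * z i); split=> [i|].
  by rewrite addr_ge0 // mulr_ge0.
rewrite big_split /= -!mulr_sumr w1 z1 !mulr1; split=> //.
by rewrite !mulr_sumr -!big_split; split; apply: eq_bigr => i _ /=; ring.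
Qed.

(* The stereographic parametrisation with pole [c + rho s], so that the
   weights [1 + t^2] turn hulls of circle points into hulls of the moment
   vectors [(1, t, t^2)]. *)
Definition circle_point (c : point) (rho : R) (s : point) (t : R) : point :=
  (c.1 + rho * (((t ^+ 2 - 1) * s.1 - 2 * t * s.2) / (t ^+ 2 + 1)),
   c.2 + rho * (((t ^+ 2 - 1) * s.2 + 2 * t * s.1) / (t ^+ 2 + 1))).

Definition unit_vector (s : point) : Prop := s.1 ^+ 2 + s.2 ^+ 2 = 1.

Lemma sqrD1_gt0 (t : R) : 0 < t ^+ 2 + 1.
Proof. by rewrite ltr_wpDl ?sqr_ge0. Qed.

Lemma sqrD1_neq0 (t : R) : t ^+ 2 + 1 != 0.
Proof. by rewrite gt_eqF ?sqrD1_gt0. Qed.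

Lemma circle_pointP (c : point) (rho : R) (s : point) (t : R) :
  unit_vector s -> on_circle c rho (circle_point c rho s t).
Proof.
rewrite /unit_vector /on_circle /= => us.
rewrite !(addrC c.1) !(addrC c.2) !addrK.
transitivity (rho ^+ 2 * (s.1 ^+ 2 + s.2 ^+ 2)); last by rewrite us mulr1.
by field; exact: sqrD1_neq0.
Qed.

Lemma circle_point_surj (c : point) (rho : R) (s q : point) :
  0 < rho -> unit_vector s -> on_circle c rho q ->
  q != (c.1 + rho * s.1, c.2 + rho * s.2) ->
  exists t, q = circle_point c rho s t.
Proof.
case: c q s => c1 c2 [q1 q2] [s1 s2] /= rho0; rewrite /unit_vector /on_circle /=.
move=> us qc qs.
have r0 : rho != 0 by rewrite gt_eqF.
pose x := (q1 - c1) / rho; pose y := (q2 - c2) / rho.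
have q1E : q1 = c1 + rho * x by rewrite /x; field.
have q2E : q2 = c2 + rho * y by rewrite /y; field.
have xy : x ^+ 2 + y ^+ 2 = 1.
  have -> : x ^+ 2 + y ^+ 2 = ((q1 - c1) ^+ 2 + (q2 - c2) ^+ 2) / rho ^+ 2.
    by rewrite /x /y; field.
  by rewrite qc divff // expf_neq0.
(* [1 - m] and [l] are the cosine and sine of the angle from the pole, so the witness [l / m] is the
   cotangent of half that angle; [m] vanishes only at the pole. *)
pose m := 1 - (s1 * x + s2 * y); pose l := s1 * y - s2 * x.
have m0 : m != 0.
  apply: contra qs => /eqP m0.
  have : (x - s1) ^+ 2 + (y - s2) ^+ 2 = 0.
    transitivity ((x ^+ 2 + y ^+ 2 + (s1 ^+ 2 + s2 ^+ 2) - 2) + 2 * m).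
      by rewrite /m; ring.
    by rewrite xy us m0; ring.
  move/eqP; rewrite paddr_eq0 ?sqr_ge0 // !sqrf_eq0 !subr_eq0.
  by case/andP => /eqP xs /eqP ys; rewrite q1E q2E xs ys.
have lm : l ^+ 2 = m * (2 - m).
  transitivity ((x ^+ 2 + y ^+ 2) * (s1 ^+ 2 + s2 ^+ 2) - (s1 * x + s2 * y) ^+ 2).
    by rewrite /l; ring.
  by rewrite xy us /m; ring.
have D : (l / m) ^+ 2 + 1 = 2 / m.
  by rewrite expr_div_n lm; field.
have N : (l / m) ^+ 2 - 1 = 2 / m * (1 - m).
  by rewrite expr_div_n lm; field.
exists (l / m); rewrite /circle_point /= D N q1E q2E.
congr (_ + rho * _, _ + rho * _).
  transitivity ((1 - m) * s1 - l * s2); last by field; rewrite m0.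
  transitivity (x * (s1 ^+ 2 + s2 ^+ 2)); first by rewrite us mulr1.
  by rewrite /m /l; ring.
transitivity ((1 - m) * s2 + l * s1); last by field; rewrite m0.
transitivity (y * (s1 ^+ 2 + s2 ^+ 2)); first by rewrite us mulr1.
by rewrite /m /l; ring.
Qed.

(* The affine function cutting the circle at the parameters [a] and [b]. *)
Lemma circle_separator (c : point) (rho : R) (s : point) (a b : R) :
  0 < rho -> unit_vector s ->
  exists al be ga, forall t,
    al + be * (circle_point c rho s t).1 + ga * (circle_point c rho s t).2
    = (t - a) * (t - b) * (2 / (t ^+ 2 + 1)).
Proof.
move=> rho0 us; have r0 : rho != 0 by rewrite gt_eqF.
(* With [(t^2 - 1) / (t^2 + 1)] and [2 t / (t^2 + 1)] as cosine and sine, the right-hand side is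
   [1 + a b + (1 - a b) cos - (a + b) sin]; [u] and [v] are these coefficients over the radius. *)
pose u := (1 - a * b) / rho; pose v := (a + b) / rho.
pose be := u * s.1 + v * s.2; pose ga := u * s.2 - v * s.1.
exists (1 + a * b - be * c.1 - ga * c.2), be, ga => t.
have t0 := sqrD1_neq0 t.
transitivity (1 + a * b + rho * (s.1 ^+ 2 + s.2 ^+ 2) *
  (u * (t ^+ 2 - 1) - v * (2 * t)) / (t ^+ 2 + 1)).
  by rewrite /be /ga /=; field.
by rewrite us /u /v; field; rewrite t0 r0.
Qed.

(** The separator with double root [a] is the tangent at that point, and it vanishes at no other
    parameter. *)
Lemma circle_point_inj (c : point) (rho : R) (s : point) :
  0 < rho -> unit_vector s -> injective (circle_point c rho s).
Proof.
move=> rho0 us a b /= ab.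
have [al [be [ga E]]] := circle_separator c a a rho0 us.
have := E b; rewrite -ab E subrr !mul0r => /esym/eqP.
rewrite !mulf_eq0 orbb invr_eq0 (negPf (sqrD1_neq0 b)) orbF pnatr_eq0 orbF.
by rewrite subr_eq0 => /eqP.
Qed.

(** The separating chord is an edge of [p]. If [p] has points on both sides of [q o], it joins the
    nearest ones and all of [q] lies between them; otherwise it joins the extreme points of [p] and
    [q] lies outside. *)
Lemma separated_or_interleaved (k : nat) (p q : 'I_k -> R) : (0 < k)%N ->
  (forall i j, p i != q j) ->
  ~~ meets <%R (codom p) (codom q) ->
  exists a b,
    ((forall i, 0 <= (p i - a) * (p i - b)) /\ (forall j, (q j - a) * (q j - b) < 0)) \/
    ((forall i, (p i - a) * (p i - b) <= 0) /\ (forall j, 0 < (q j - a) * (q j - b))).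
Proof.
move=> k0 pq; rewrite negb_or => /andP[npq nqp].
have A i j i' j' : p i < q j -> q j < p i' -> p i' < q j' -> False.
  move=> *; case/negP: npq; apply/interleaveP.
  by exists (p i), (q j), (p i'), (q j'); rewrite !codom_f.
have B i j i' j' : q j < p i -> p i < q j' -> q j' < p i' -> False.
  move=> *; case/negP: nqp; apply/interleaveP.
  by exists (q j), (p i), (q j'), (p i'); rewrite !codom_f.
have cmp i j : {p i < q j} + {q j < p i}.
  by case: (ltgtP (p i) (q j)) (pq i j) => //; [left|right].
pose o : 'I_k := Ordinal k0; pose z := q o.
have [m _ mP] : extremum_spec <=%O xpredT p (Order.arg_min o xpredT p) by exact: arg_minP.
have [M _ MP] : extremum_spec >=%O xpredT p (Order.arg_max o xpredT p) by exact: arg_maxP.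
have out : (forall j, p m < q j -> q j < p M -> False) ->
    exists a b,
    ((forall i, 0 <= (p i - a) * (p i - b)) /\ (forall j, (q j - a) * (q j - b) < 0)) \/
    ((forall i, (p i - a) * (p i - b) <= 0) /\ (forall j, 0 < (q j - a) * (q j - b))).
  move=> P; exists (p m), (p M); right; split=> [i|j].
    by rewrite mulr_ge0_le0 ?subr_ge0 ?subr_le0; [| exact: mP | exact: MP].
  have [lt0|gt0] := cmp m j; last first.
    by rewrite nmulr_rgt0 ?subr_lt0 // (lt_le_trans gt0) // mP.
  have [lt1|gt1] := cmp M j; first by rewrite mulr_gt0 // subr_gt0.
  by case: (P j).
have [/existsP[i0 i0z]|/existsPn noL] := boolP [exists i, p i < z]; last first.
  by apply: out => j mj jM; apply: (@B m o M j) => //; case: (cmp m o) (noL m) => // ->.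
have [/existsP[i1 i1z]|/existsPn noR] := boolP [exists i, z < p i]; last first.
  by apply: out => j mj jM; apply: (@A m j M o) => //; case: (cmp M o) (noR M) => // ->.
case: (@arg_maxP _ _ _ i0 (fun i => p i < z) p) => // a az aP.
case: (@arg_minP _ _ _ i1 (fun i => z < p i) p) => // b bz bP.
exists (p a), (p b); left; split=> [i|j].
  have [iz|iz] := cmp i o.
    have ia := aP i iz; have zb : p a < p b := lt_trans az bz.
    by rewrite mulr_le0 ?subr_le0 // (le_trans ia) ?ltW.
  have ia := bP i iz; have zb : p a < p b := lt_trans az bz.
  by rewrite mulr_ge0 ?subr_ge0 // (le_trans _ ia) ?ltW.
have [aj|ja] := cmp a j; last by case: (@B a j b o).
have [bj|jb] := cmp b j; first by case: (@A a o b j).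
by rewrite pmulr_rlt0 ?subr_gt0 ?subr_lt0.
Qed.

(* The weights are the coefficients of the linear relation between four points
   of the moment curve (divided differences of order three). *)
Lemma interleave_hulls (k : nat) (c : point) (rho : R) (s : point) (p q : 'I_k -> R) :
  interleave <%R (codom p) (codom q) ->
  exists x, in_hull (circle_point c rho s \o p) x /\
            in_hull (circle_point c rho s \o q) x.
Proof.
move=> /interleaveP[_ [_ [_ [_ [[/codomP[i1 ->] /codomP[i2 ->] /codomP[i3 ->] /codomP[i4 ->]]]]]]].
set t1 := p i1; set t2 := q i2; set t3 := p i3; set t4 := q i4 => -[t12 t23 t34].
have t24 := lt_trans t23 t34; have t13 := lt_trans t12 t23; have t14 := lt_trans t12 t24.
pose w1 := (t3 - t2) * (t4 - t2) * (t4 - t3) * (t1 ^+ 2 + 1).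
pose w2 := (t3 - t1) * (t4 - t1) * (t4 - t3) * (t2 ^+ 2 + 1).
pose w3 := (t2 - t1) * (t4 - t1) * (t4 - t2) * (t3 ^+ 2 + 1).
pose w4 := (t2 - t1) * (t3 - t1) * (t3 - t2) * (t4 ^+ 2 + 1).
have [w10 w20 w30 w40] : [/\ 0 < w1, 0 < w2, 0 < w3 & 0 < w4].
  by split; rewrite !mulr_gt0 ?subr_gt0 ?sqrD1_gt0.
have W : w1 + w3 = w2 + w4 by rewrite /w1 /w2 /w3 /w4; ring.
have W0 : 0 < w1 + w3 by rewrite addr_gt0.
have W0' : w1 + w3 != 0 by rewrite gt_eqF.
have n1 := sqrD1_neq0 t1; have n2 := sqrD1_neq0 t2.
have n3 := sqrD1_neq0 t3; have n4 := sqrD1_neq0 t4.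
have E g h : w1 * (((t1 ^+ 2 - 1) * g + 2 * t1 * h) / (t1 ^+ 2 + 1))
         + w3 * (((t3 ^+ 2 - 1) * g + 2 * t3 * h) / (t3 ^+ 2 + 1))
         = w2 * (((t2 ^+ 2 - 1) * g + 2 * t2 * h) / (t2 ^+ 2 + 1))
         + w4 * (((t4 ^+ 2 - 1) * g + 2 * t4 * h) / (t4 ^+ 2 + 1)).
  by rewrite /w1 /w2 /w3 /w4; field; rewrite n1 n2 n3 n4.
have F (d g h : R) : w1 / (w1 + w3) * (d + rho * (((t1 ^+ 2 - 1) * g + 2 * t1 * h) / (t1 ^+ 2 + 1)))
         + w3 / (w1 + w3) * (d + rho * (((t3 ^+ 2 - 1) * g + 2 * t3 * h) / (t3 ^+ 2 + 1)))
         = w2 / (w1 + w3) * (d + rho * (((t2 ^+ 2 - 1) * g + 2 * t2 * h) / (t2 ^+ 2 + 1)))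
         + w4 / (w1 + w3) * (d + rho * (((t4 ^+ 2 - 1) * g + 2 * t4 * h) / (t4 ^+ 2 + 1))).
  have := E g h.
  set a1 := _ / (t1 ^+ 2 + 1); set a2 := _ / (t2 ^+ 2 + 1).
  set a3 := _ / (t3 ^+ 2 + 1); set a4 := _ / (t4 ^+ 2 + 1) => {}E.
  have G (x y a b : R) : x / (w1 + w3) * (d + rho * a) + y / (w1 + w3) * (d + rho * b) =
     ((x + y) * d + rho * (x * a + y * b)) / (w1 + w3) by field.
  by rewrite !G E W.
have D : w1 / (w1 + w3) + w3 / (w1 + w3) = 1 by rewrite -mulrDl divff.
have D' : w2 / (w1 + w3) + w4 / (w1 + w3) = 1 by rewrite -mulrDl -W divff.
have pos x : 0 < x -> 0 <= x / (w1 + w3) by move=> x0; rewrite ltW // divr_gt0.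
have h1 := hull_vertex (circle_point c rho s \o p) i1.
have h3 := hull_vertex (circle_point c rho s \o p) i3.
have h2 := hull_vertex (circle_point c rho s \o q) i2.
have h4 := hull_vertex (circle_point c rho s \o q) i4.
have P := hull_convex (pos _ w10) (pos _ w30) D h1 h3.
have Q := hull_convex (pos _ w20) (pos _ w40) D' h2 h4.
move: P Q; rewrite /= -![- (2 * _ * _)]mulrN F [in X in in_hull _ X -> _]F => P Q.
by eexists; split; [exact: P|exact: Q].
Qed.

(** The separating chord passes through vertices of one polygon, so its inequality is weak on that
    polygon and strict on the other, which still excludes a common point. Shared vertices form a
    separate case because [meets] uses strict comparisons. *)
Lemma hulls_meet (k : nat) (c : point) (rho : R) (s : point) (p q : 'I_k -> R) :
  0 < rho -> unit_vector s -> (0 < k)%N ->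
  (exists x, in_hull (circle_point c rho s \o p) x /\
             in_hull (circle_point c rho s \o q) x) <->
  has (mem (codom q)) (codom p) || meets <%R (codom p) (codom q).
Proof.
move=> rho0 us k0; split; last first.
  case/orP => [/hasP[_ /codomP[i ->] /codomP[j pq]]|/orP[|]].
  - exists (circle_point c rho s (p i)); split; first exact: (hull_vertex (_ \o p)).
    by rewrite pq; exact: (hull_vertex (_ \o q)).
  - exact: interleave_hulls.
  - by move=> /(interleave_hulls c rho s)[x [? ?]]; exists x.
move=> [x [px qx]]; apply/negPn/negP; rewrite negb_or => /andP[/hasPn npq nm].
have pq i j : p i != q j.
  by apply: contra (npq _ (codom_f p i)) => /eqP ->; exact: codom_f.
have [a [b sep]] := separated_or_interleaved k0 pq nm.
have [al [be [ga E]]] := circle_separator c a b rho0 us.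
have g0 (t : R) : 0 < 2 / (t ^+ 2 + 1) by rewrite divr_gt0 ?sqrD1_gt0 ?ltr0n.
have neg (y z : R) : - al + - be * y + - ga * z = - (al + be * y + ga * z) by ring.
case: sep => -[P Q].
  have P' : 0 <= al + be * x.1 + ga * x.2.
    by apply: (hull_affine_ge0 px) => i; rewrite E mulr_ge0 // ltW.
  have : 0 < - al + - be * x.1 + - ga * x.2.
    by apply: (hull_affine_gt0 qx) => i; rewrite neg E -mulNr mulr_gt0 // oppr_gt0.
  by rewrite neg oppr_gt0 ltNge P'.
have Q' : 0 < al + be * x.1 + ga * x.2.
  by apply: (hull_affine_gt0 qx) => i; rewrite E mulr_gt0.
have : 0 <= - al + - be * x.1 + - ga * x.2.
  by apply: (hull_affine_ge0 px) => i; rewrite neg E -mulNr mulr_ge0 ?oppr_ge0 // ltW.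
by rewrite neg oppr_ge0 leNgt Q'.
Qed.

End Circle.

(** * Polygons as sets of slots *)

(** [meets] compares only points of different families, so the order inside each family need not be
    preserved. *)
Lemma eq_meets_codom (I : finType) (T T' : eqType) (lt : rel T) (lt' : rel T')
    (p q : I -> T) (p' q' : I -> T') :
  (forall i j, lt (p i) (q j) = lt' (p' i) (q' j)) ->
  (forall i j, lt (q i) (p j) = lt' (q' i) (p' j)) ->
  meets lt (codom p) (codom q) = meets lt' (codom p') (codom q').
Proof.
have H (T1 T2 : eqType) (l1 : rel T1) (l2 : rel T2) (p1 q1 : I -> T1) (p2 q2 : I -> T2) :
    (forall i j, l1 (p1 i) (q1 j) = l2 (p2 i) (q2 j)) ->
    (forall i j, l1 (q1 i) (p1 j) = l2 (q2 i) (p2 j)) ->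
    interleave l1 (codom p1) (codom q1) -> interleave l2 (codom p2) (codom q2).
  move=> pq qp /interleaveP[x [y [z [w [[]]]]]].
  move=> /codomP[a ->] /codomP[b ->] /codomP[c ->] /codomP[d ->].
  rewrite !pq qp => lts; apply/interleaveP.
  by exists (p2 a), (q2 b), (p2 c), (q2 d); rewrite !codom_f.
move=> pq qp; congr orb; apply/idP/idP; apply: H => // i j; symmetry; auto.
Qed.

Section Models.
Import Order.TTheory GRing.Theory Num.Theory.
Local Open Scope ring_scope.

Lemma unit_vector10 : unit_vector (1, 0).
Proof. by rewrite /unit_vector /= expr1n expr0n addr0. Qed.

Lemma unit_circle_point (a : R) : unit_vector (circle_point (0, 0) 1 (1, 0) a).
Proof.
have := circle_pointP (0, 0) 1 a unit_vector10.
by rewrite /unit_vector /on_circle !subr0 expr1n.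
Qed.

Lemma polygon_parameters (k n : nat) (e : rel 'I_n) : (0 < k)%N ->
  k_polygon_circle k e ->
  exists T : 'I_n -> 'I_k -> R, (forall v, injective (T v)) /\
    forall u v, u != v ->
      (e u v <-> has (mem (codom (T v))) (codom (T u)) ||
                 meets <%R (codom (T u)) (codom (T v))).
Proof.
move=> k0 [c [rho [P [rho0 [Pinj [Pc Pe]]]]]].
have u10 := unit_vector10.
(* The naturals give infinitely many circle points, so one of them avoids the finitely many vertices
   and can serve as the pole. *)
pose pole (m : nat) := circle_point (0, 0) 1 (1, 0) m%:R.
pose far m : point := (c.1 + rho * (pole m).1, c.2 + rho * (pole m).2).
have far_inj : injective far.
  move=> m m' [/addrI mm1 /addrI mm2].
  have r0 : rho != 0 by rewrite gt_eqF.
  have e1 : (pole m).1 = (pole m').1 by exact: (mulfI r0).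
  have e2 : (pole m).2 = (pole m').2 by exact: (mulfI r0).
  have {e1 e2} : pole m = pole m'.
    by rewrite (surjective_pairing (pole m)) e1 e2 -surjective_pairing.
  by move/(circle_point_inj ltr01 unit_vector10)/eqP; rewrite eqr_nat => /eqP.
have [m farP] : exists m, forall v i, P v i != far m.
  pose N := #|{: 'I_n * 'I_k}|.
  have [/existsP[m /forallP mP]|/existsPn all_hit] :=
      boolP [exists m : 'I_N.+1, forall x : 'I_n * 'I_k, P x.1 x.2 != far m].
    by exists m => v i; exact: (mP (v, i)).
  have hit (m : 'I_N.+1) : exists x : 'I_n * 'I_k, P x.1 x.2 == far m.
    by have /forallPn[x /negPn] := all_hit m; exists x.
  pose f m := xchoose (hit m).
  have fP m : P (f m).1 (f m).2 = far m by apply/eqP; exact: (xchooseP (hit m)).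
  have finj : injective f by move=> i j fij; apply/val_inj/far_inj; rewrite -!fP fij.
  by have := leq_card f finj; rewrite card_ord ltnn.
have us : unit_vector (pole m) by exact: unit_circle_point.
have tP v i : exists t, P v i == circle_point c rho (pole m) t.
  by have [t ->] := circle_point_surj rho0 us (Pc v i) (farP v i); exists t.
pose T v i := xchoose (tP v i).
have TP v i : P v i = circle_point c rho (pole m) (T v i).
  by apply/eqP; exact: (xchooseP (tP v i)).
exists T; split=> [v i j Tij|u v uv]; first by apply: (Pinj v); rewrite !TP Tij.
rewrite (Pe u v uv) -(hulls_meet c (T u) (T v) rho0 us k0).
have hullE w x : in_hull (P w) x <-> in_hull (circle_point c rho (pole m) \o T w) x.
  by split=> -[z [z0 [z1 [x1 x2]]]]; exists z; rewrite x1 x2; do !split=> //;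
     apply: eq_bigr => i _; rewrite ?TP //= -TP.
by split=> -[x [/hullE xu /hullE xv]]; exists x; split.
Qed.

(** The way back to geometry: the slots themselves serve as stereographic parameters on the unit
    circle. *)
Lemma slots_polygons (k n : nat) (e : rel 'I_n) (S : 'I_n -> seq nat) : (0 < k)%N ->
  (forall v, size (S v) = k) -> (forall v, sorted ltn (S v)) ->
  (forall u v, u != v -> ~~ has (mem (S v)) (S u)) ->
  (forall u v, u != v -> e u v = meets ltn (S u) (S v)) ->
  k_polygon_circle k e.
Proof.
move=> k0 Sk Ss Sd Se; pose T v (i : 'I_k) : R := (nth 0%N (S v) i)%:R.
have u10 := unit_vector10.
have r1 : (0 : R) < 1 by rewrite ltr01.
exists (0, 0), 1, (fun v => circle_point (0, 0) 1 (1, 0) \o T v).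
split=> //; split=> [v i j|].
  move/(circle_point_inj r1 u10)/eqP; rewrite eqr_nat nth_uniq ?Sk //.
    by move/eqP/val_inj.
  exact: (sorted_uniq ltn_trans ltnn).
split=> [v i|u v uv]; first exact: circle_pointP.
rewrite (hulls_meet (0, 0) (T u) (T v) r1 u10 k0) Se //.
pose U w (i : 'I_k) := nth 0%N (S w) i.
have US w : S w =i codom (U w).
  move=> x; apply/idP/codomP => [/(nthP 0%N)[i]|[i ->]]; last by rewrite mem_nth ?Sk.
  by rewrite Sk => ik <-; exists (Ordinal ik).
have -> : has (mem (codom (T v))) (codom (T u)) = false.
  apply/hasP => -[_ /codomP[i ->] /codomP[j /eqP]]; rewrite eqr_nat => /eqP ij.
  have /hasP := Sd u v uv; apply; exists (U u i); first by rewrite mem_nth ?Sk.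
  by rewrite /= /U ij mem_nth ?Sk.
rewrite (eq_mem_meets _ (US u) (US v)) /= (@eq_meets_codom _ _ _ _ <%R _ _ (T u) (T v)) //.
  by move=> i j; rewrite ltr_nat.
by move=> i j; rewrite ltr_nat.
Qed.

End Models.

(** * Replacing real parameters by integers *)

Section Rank.
Variables (I : finType) (d : Order.disp_t) (T : orderType d) (F : I -> T).

(** Equal values share a rank. Ranks first compress the real parameters while keeping coincidences,
    and later number the distinct keys consecutively. *)
Definition rank (x : I) : nat := #|[pred z | (F z < F x)%O]|.

Lemma ltn_rank x y : (rank x < rank y) = (F x < F y)%O.
Proof.
have le a b : (F a <= F b)%O -> rank a <= rank b.
  move=> ab; apply/subset_leq_card/subsetP => z; rewrite !inE => za.
  exact: Order.POrderTheory.lt_le_trans za ab.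
case: (Order.TotalTheory.leP (F y) (F x)) => [yx|xy]; first by apply/negbTE; rewrite -leqNgt le.
apply/proper_card/properP; split.
  apply/subsetP => z; rewrite !inE => za; exact: Order.POrderTheory.lt_trans za xy.
by exists x; rewrite !inE ?xy ?Order.POrderTheory.ltxx.
Qed.

Lemma rank_lt x : rank x < #|I|.
Proof.
apply/proper_card/properP; split; first exact/subsetP.
by exists x; rewrite !inE ?Order.POrderTheory.ltxx.
Qed.

Lemma eq_rank x y : (rank x == rank y) = (F x == F y).
Proof.
have := ltn_rank x y; have := ltn_rank y x.
case: (Order.TotalTheory.ltgtP (F x) (F y)) => [_ lt gt|_ lt gt|_].
- by rewrite ltn_eqF.
- by rewrite gtn_eqF.
- by case: (ltngtP (rank x) (rank y)).
Qed.

Lemma perm_rank : injective F -> perm_eq [seq rank x | x <- enum I] (iota 0 #|I|).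
Proof.
move=> Finj.
have U : uniq [seq rank x | x <- enum I].
  by rewrite map_inj_uniq ?enum_uniq // => x y /eqP; rewrite eq_rank => /eqP /Finj.
apply: uniq_perm => //; first exact: iota_uniq.
apply: (uniq_min_size U _ _).2; last by rewrite size_iota size_map -cardE.
by move=> _ /mapP[x _ ->]; rewrite mem_iota rank_lt.
Qed.

End Rank.

(** Undoing a rotation turns an alternating quadruple into one of its four cyclic shifts; an odd
    shift exchanges the two sets, which is why the conclusion needs [meets] rather than
    [interleave]. *)
Lemma meets_rotate (c P : nat) (s t : seq nat) : c <= P ->
  {in s, forall x, x < P} -> {in t, forall x, x < P} ->
  meets ltn [seq (x + c) %% P | x <- s] [seq (x + c) %% P | x <- t] ->
  meets ltn s t.
Proof.
move=> cP sP tP.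
have rot x : x < P -> (x + c) %% P = if x + c < P then x + c else x + c - P.
  move=> xP; case: ltnP => [?|Px]; first exact: modn_small.
  by rewrite -{1}(subnK Px) modnDr modn_small //; lia.
have H (s1 t1 : seq nat) : {in s1, forall x, x < P} -> {in t1, forall x, x < P} ->
    interleave ltn [seq (x + c) %% P | x <- s1] [seq (x + c) %% P | x <- t1] ->
    meets ltn s1 t1.
  move=> s1P t1P /interleaveP[x' [y' [z' [w' [[]]]]]].
  move=> /mapP[x xs ->] /mapP[y yt ->] /mapP[z zs ->] /mapP[w wt ->].
  have xP := s1P x xs; have yP := t1P y yt; have zP := s1P z zs; have wP := t1P w wt.
  rewrite !rot // => -[xy yz zw].
  have : [\/ [/\ x < y, y < z & z < w], [/\ y < z, z < w & w < x],
            [/\ z < w, w < x & x < y] | [/\ w < x, x < y & y < z]].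
    move: xy yz zw; case: (ltnP (x + c)) => ?; case: (ltnP (y + c)) => ?;
      case: (ltnP (z + c)) => ?; case: (ltnP (w + c)) => ? /= *;
      first [constructor 1; split; lia | constructor 2; split; lia
           | constructor 3; split; lia | constructor 4; split; lia].
  case=> L; apply/orP; [left|right|left|right]; apply/interleaveP.
  - by exists x, y, z, w.
  - by exists y, z, w, x.
  - by exists z, w, x, y.
  - by exists w, x, y, z.
by rewrite {1}/meets => /orP[|] /H; [apply|rewrite meetsC; apply].
Qed.

Lemma ltn_digits (m a b c d : nat) : b < m -> a < c -> a * m + b < c * m + d.
Proof. by move=> bm ac; have := leq_mul ac (leqnn m); rewrite mulSn; lia. Qed.

(** * Splitting shared vertices into distinct positions *)

Section TieBreak.
Variables (k M n : nat).
Hypothesis k_gt1 : 1 < k.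

(** [M - p i] stands for [- p i] modulo [M]. The seed [M] exceeds every residue, so with [1 < k] it
    is never the minimum. *)
Definition next_gap (p : 'I_k -> nat) (i : 'I_k) : nat :=
  \big[Order.min/M]_(j | j != i) ((p j + (M - p i)) %% M).

(* Vertices sharing a point are ordered by the cyclic distance to the next
   vertex of their polygon, which makes the two polygons interleave. *)
Definition key (p : 'I_k -> nat) (v : nat) (i : 'I_k) : nat :=
  (p i * M + next_gap p i) * n + v.

Lemma next_gap_le (p : 'I_k -> nat) (i j : 'I_k) : j != i ->
  next_gap p i <= (p j + (M - p i)) %% M.
Proof.
exact: (@Order.TotalTheory.bigmin_le_cond _ nat _ M j (fun l => l != i)
  (fun l => (p l + (M - p i)) %% M)).
Qed.

Lemma next_gapP (p : 'I_k -> nat) (i : 'I_k) : (forall j, p j < M) ->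
  exists2 j, j != i & next_gap p i = (p j + (M - p i)) %% M.
Proof.
move=> pM; have M0 : 0 < M by apply: leq_ltn_trans (pM i).
have [j ji] : exists j : 'I_k, j != i.
  have : 1 < #|'I_k| by rewrite card_ord.
  by rewrite (cardD1 i) inE => /card_gt0P[j]; rewrite !inE => /andP[ji _]; exists j.
have lt : next_gap p i < M by apply: leq_ltn_trans (next_gap_le p ji) _; rewrite ltn_mod.
have [// | eq] : (exists2 j, j != i & next_gap p i = (p j + (M - p i)) %% M)
    \/ next_gap p i = M.
  rewrite /next_gap.
  elim/big_rec: _ => [|l x li [[h hi ->]|->]]; rewrite ?Order.NatOrder.minEnat; first by right.
    case: (leqP ((p l + (M - p i)) %% M) ((p h + (M - p i)) %% M)) => c; left.
      by exists l => //; apply/minn_idPl.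
    by exists h => //; apply/minn_idPr/ltnW.
  by left; exists l => //; apply/minn_idPl/ltnW; rewrite ltn_mod.
by rewrite eq ltnn in lt.
Qed.

Lemma next_gap_lt (p : 'I_k -> nat) (i : 'I_k) : (forall j, p j < M) -> next_gap p i < M.
Proof.
move=> pM; have [j _ ->] := next_gapP i pM; rewrite ltn_mod.
exact: leq_ltn_trans (pM i).
Qed.

Lemma key_lt (p q : 'I_k -> nat) (u v : nat) (i j : 'I_k) :
  (forall l, p l < M) -> u < n -> p i < q j -> key p u i < key q v j.
Proof.
by move=> pM un pq; do 2 apply: ltn_digits => //; exact: next_gap_lt.
Qed.

Lemma key_next_gap_lt (p q : 'I_k -> nat) (u v : nat) (i j : 'I_k) :
  u < n -> p i = q j -> next_gap p i < next_gap q j -> key p u i < key q v j.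
Proof. by rewrite /key => un -> gap; apply: ltn_digits; rewrite ?ltn_add2l. Qed.

Lemma key_inj (p q : 'I_k -> nat) (u v : nat) (i j : 'I_k) :
  (forall l, p l < M) -> (forall l, q l < M) -> u < n -> v < n ->
  key p u i = key q v j -> p i = q j /\ u = v.
Proof.
move=> pM qM un vn; have := next_gap_lt i pM; have := next_gap_lt j qM.
rewrite /key => g1 g2 E.
have [E1 E2] : p i * M + next_gap p i = q j * M + next_gap q j /\ u = v.
  have n0 : 0 < n by lia.
  have := congr1 (modn^~ n) E; rewrite !modnMDl !modn_small // => uv; split=> //.
  by move: E; rewrite uv => /addIn /eqP; rewrite eqn_pmul2r // => /eqP.
have M0 : 0 < M by lia.
by have := congr1 (divn^~ M) E1; rewrite !divnMDl // !divn_small // !addn0.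
Qed.

Lemma key_bound (p : 'I_k -> nat) (u : nat) (i : 'I_k) :
  (forall l, p l < M) -> u < n -> key p u i < M * M * n.
Proof.
move=> pM un; rewrite /key -[M * M * n]addn0; apply: ltn_digits => //.
by rewrite -[M * M]addn0; apply: ltn_digits => //; exact: next_gap_lt.
Qed.

(** At the shared point, the polygon with the smaller key has the nearer next vertex, so the two
    alternate at once unless the next vertices coincide as well. In that case the tie at this second
    point decides whether [i1] or the vertex after it completes the alternation. *)
Lemma keys_meet_at0 (p q : 'I_k -> nat) (u v : nat) (i0 j0 : 'I_k) :
  injective p -> injective q -> (forall l, p l < M) -> (forall l, q l < M) ->
  u < n -> v < n -> u != v -> p i0 = 0 -> q j0 = 0 ->
  meets ltn (codom (key p u)) (codom (key q v)).
Proof.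
move=> + + + + un vn uv.
wlog lt_key : p q u v i0 j0 un vn uv / key q v j0 < key p u i0.
  move=> W pinj qinj pM qM p0 q0.
  case: (ltngtP (key q v j0) (key p u i0)) => [lt|lt|E].
  - exact: (W p q u v i0 j0).
  - by rewrite meetsC; apply: (W q p v u j0 i0) => //; rewrite eq_sym.
  - by have [_ E'] := key_inj qM pM vn un E; rewrite E' eqxx in uv.
move=> pinj qinj pM qM p0 q0.
have done i1 j1 : key p u i0 < key q v j1 -> key q v j1 < key p u i1 ->
    meets ltn (codom (key p u)) (codom (key q v)).
  move=> lt1 lt2; apply/orP; right; apply/interleaveP.
  by exists (key q v j0), (key p u i0), (key q v j1), (key p u i1); rewrite !codom_f.
have [j1 j10 b] := next_gapP j0 qM; have [i1 i10 a] := next_gapP i0 pM.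
rewrite q0 subn0 modnDr modn_small // in b; rewrite p0 subn0 modnDr modn_small // in a.
have b0 : 0 < q j1 by rewrite lt0n; apply: contra j10 => /eqP E; apply/eqP/qinj; rewrite E.
have ab : q j1 <= p i1.
  rewrite -a -b leqNgt; apply/negP => ab.
  by have := key_next_gap_lt v un (etrans p0 (esym q0)) ab; rewrite ltnNge ltnW.
have lt1 : key p u i0 < key q v j1 by apply: key_lt; rewrite ?p0.
move: ab; rewrite leq_eqVlt => /orP[/eqP ab|ab]; last first.
  by apply: (done i1 j1) => //; apply: key_lt.
have [lt2|] := ltnP (key q v j1) (key p u i1); first exact: (done i1 j1).
move=> lt2.
have gap : next_gap p i1 < next_gap q j1.
  have vu : v < u by move: lt_key; rewrite /key p0 q0 a b ab ltn_add2l.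
  by move: lt2; rewrite /key ab; nia.
have [i2 i21 c] := next_gapP i1 pM.
(* Going on from [q j1] to [q j0] at 0 bounds its gap by [M - q j1]. The strictly smaller gap of
   [p i1] cannot wrap past 0, so [p i2] lies beyond [q j1]. *)
have := next_gap_le q (i := j1) (j := j0); rewrite eq_sym j10 => /(_ isT).
rewrite q0 add0n modn_small; last by have := qM j1; lia.
move=> gapq; apply: (done i2 j1) => //; apply: key_lt => //.
have n21 : p i2 != p i1 by apply: contra i21 => /eqP /pinj ->.
rewrite ab ltn_neqAle eq_sym n21 /= leqNgt; apply/negP => lt.
have := pM i1; move: c; rewrite modn_small; lia.
Qed.

(** Rotating positions by [c] keeps all cyclic gaps, hence rotates keys by [c * M * n] modulo
    [M * M * n]; this moves the shared vertex to 0. *)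
Lemma keys_meet (p q : 'I_k -> nat) (u v : nat) (i0 j0 : 'I_k) :
  injective p -> injective q -> (forall l, p l < M) -> (forall l, q l < M) ->
  u < n -> v < n -> u != v -> p i0 = q j0 ->
  meets ltn (codom (key p u)) (codom (key q v)).
Proof.
move=> pinj qinj pM qM un vn uv p0.
have M0 : 0 < M by apply: leq_ltn_trans (pM i0).
pose c := M - p i0; pose rot (f : 'I_k -> nat) i := (f i + c) %% M.
have rotM f l : rot f l < M by rewrite ltn_mod.
have rot_inj f : injective f -> (forall l, f l < M) -> injective (rot f).
  move=> finj fM i j /eqP; rewrite eqn_modDr !modn_small // => /eqP; exact: finj.
have gapE f i : (forall l, f l < M) -> next_gap (rot f) i = next_gap f i.
  move=> fM; apply: eq_bigr => j _; apply/eqP.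
  rewrite -(eqn_modDr (rot f i)) -addnA subnK; last exact/ltnW.
  rewrite modnDr modn_mod /rot modnDmr addnA -(addnA (f j)) subnK; last exact/ltnW.
  by rewrite addnAC modnDr.
have keyE f w i : (forall l, f l < M) -> w < n ->
    key (rot f) w i = (key f w i + c * M * n) %% (M * M * n).
  move=> fM wn; have := key_bound i (rotM f) wn; rewrite /key gapE // => B.
  rewrite -[LHS](modn_small B).
  have -> : (f i * M + next_gap f i) * n + w + c * M * n =
    ((f i + c) * M + next_gap f i) * n + w by ring.
  rewrite [in RHS](divn_eq (f i + c) M) -/(rot f i).
  have -> : (((f i + c) %/ M * M + rot f i) * M + next_gap f i) * n + w =
     (f i + c) %/ M * (M * M * n) + ((rot f i * M + next_gap f i) * n + w) by ring.
  by rewrite modnMDl.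
have codomE f w : (forall l, f l < M) -> w < n ->
    codom (key (rot f) w) = [seq (x + c * M * n) %% (M * M * n) | x <- codom (key f w)].
  by move=> fM wn; rewrite /codom /image_mem -map_comp; apply: eq_map => i; exact: keyE.
apply: (@meets_rotate (c * M * n) (M * M * n)).
- by rewrite !leq_mul // leq_subr.
- by move=> _ /codomP[i ->]; exact: key_bound.
- by move=> _ /codomP[i ->]; exact: key_bound.
rewrite -!codomE //.
have pc : p i0 + c = M by rewrite /c subnKC // ltnW.
apply: (@keys_meet_at0 _ _ _ _ i0 j0) => //; try exact: rot_inj.
  by rewrite /rot pc modnn.
by rewrite /rot -p0 pc modnn.
Qed.

End TieBreak.

(** Keys refine the order of positions, so polygons without a common vertex keep their mutual
    comparisons, while polygons with one intersect and are made to interleave by [keys_meet].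
    Ranking the keys then fills an initial segment of the integers. *)
Lemma polygon_slots (k n : nat) (e : rel 'I_n) : 1 < k -> k_polygon_circle k e ->
  exists S : 'I_n -> seq nat,
    [/\ forall v, size (S v) = k, forall v, sorted ltn (S v),
        perm_eq (flatten [seq S v | v <- enum 'I_n]) (iota 0 (n * k)) &
        forall u v, u != v -> e u v = meets ltn (S u) (S v)].
Proof.
move=> k1 /(polygon_parameters (ltnW k1))[T [Tinj Te]].
pose M := #|{: 'I_n * 'I_k}|.
pose tau v i := rank (fun x : 'I_n * 'I_k => T x.1 x.2) (v, i).
have tauM v i : tau v i < M by exact: rank_lt.
have tau_inj v : injective (tau v).
  by move=> i j /eqP; rewrite /tau eq_rank => /eqP /Tinj.
pose K (x : 'I_n * 'I_k) := key M n (tau x.1) x.1 x.2.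
have Kinj : injective K.
  move=> [u i] [v j] /(key_inj k1 (tauM _) (tauM _) (ltn_ord _) (ltn_ord _)) /= [+ uv].
  by move/val_inj: uv => -> /tau_inj ->.
pose S0 v := [seq rank K (v, i) | i <- enum 'I_k].
have S0E v : S0 v = codom (fun i => rank K (v, i)) by [].
have PS v : perm_eq (sort leq (S0 v)) (S0 v) by rewrite perm_sort.
exists (fun v => sort leq (S0 v)); split=> [v|v||u v uv].
- by rewrite size_sort size_map size_enum_ord.
- rewrite ltn_sorted_uniq_leq sort_sorted ?andbT; last exact: leq_total.
  rewrite sort_uniq map_inj_uniq ?enum_uniq // => i j /eqP.
  by rewrite eq_rank => /eqP /Kinj [].
- apply: (@perm_trans _ (flatten [seq S0 v | v <- enum 'I_n])).
    by elim: (enum 'I_n) => //= v s IH; apply: perm_cat.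
  have -> : n * k = #|{: 'I_n * 'I_k}| by rewrite card_prod !card_ord.
  apply: perm_trans (perm_rank Kinj).
  rewrite -[X in perm_eq X]/[seq rank K (v, i) | v <- enum 'I_n, i <- enum 'I_k].
  rewrite -(map_allpairs (rank K) (fun v i => (v, i))) perm_map //.
  apply: uniq_perm; rewrite ?enum_uniq //.
    by apply: allpairs_uniq; rewrite ?enum_uniq // => -[? ?] [? ?].
  by move=> [v i]; rewrite mem_enum; apply/allpairsP; exists (v, i); rewrite !mem_enum.
have -> : meets ltn (sort leq (S0 u)) (sort leq (S0 v)) =
          meets ltn (codom (fun i => K (u, i))) (codom (fun i => K (v, i))).
  rewrite (eq_mem_meets _ (perm_mem (PS u)) (perm_mem (PS v))) !S0E.
  by apply: eq_meets_codom => i j; rewrite /= ltn_rank.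
have [sh|nsh] := boolP (has (mem (codom (T v))) (codom (T u))).
  have -> : e u v by apply/(Te u v uv); rewrite sh.
  case/hasP: sh => _ /codomP[i ->] /codomP[j ij]; apply/esym.
  apply: (@keys_meet k M n k1 (tau u) (tau v) u v i j) => //; try exact: tau_inj.
  by apply/eqP; rewrite /tau eq_rank /= ij.
have lt_tau x y i j : (tau x i < tau y j) = (T x i < T y j)%R by exact: ltn_rank.
have cmp x y : (forall i j, tau x i != tau y j) ->
    forall i j, (T x i < T y j)%R = (K (x, i) < K (y, j)).
  move=> ne i j; rewrite -lt_tau; case: (ltngtP (tau x i) (tau y j)) (ne i j) => // lt _.
    by apply/esym; exact: key_lt.
  by apply/esym/negbTE; rewrite -leqNgt ltnW //; exact: key_lt.
have ne i j : tau u i != tau v j.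
  apply: contra nsh; rewrite /tau eq_rank /= => /eqP E.
  by apply/hasP; exists (T u i); rewrite ?codom_f //= E codom_f.
have ne' i j : tau v i != tau u j by rewrite eq_sym.
have E : meets <%R%R (codom (T u)) (codom (T v)) =
    meets ltn (codom (fun i => K (u, i))) (codom (fun i => K (v, i))).
  by apply: eq_meets_codom => i j; apply: cmp.
by apply/idP/idP => [/(Te u v uv)|m]; [|apply/(Te u v uv)]; rewrite (negPf nsh) /= ?E // -E.
Qed.

(** * Binary encoding, hashing and paths of states *)

Fixpoint bits_of_nat (q x : nat) : bits :=
  if q is q'.+1 then odd x :: bits_of_nat q' x./2 else [::].

Fixpoint nat_of_bits (b : bits) : nat :=
  if b is c :: b' then c + (nat_of_bits b').*2 else 0.

Definition encode (q : nat) (s : seq nat) : bits :=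
  flatten [seq bits_of_nat q x | x <- s].

(** Total on arbitrary strings from Merlin: missing bits read as zero and excess bits are
    ignored. *)
Fixpoint decode (q m : nat) (b : bits) : seq nat :=
  if m is m'.+1 then nat_of_bits (take q b) :: decode q m' (drop q b) else [::].

Lemma size_bits_of_nat q x : size (bits_of_nat q x) = q.
Proof. by elim: q x => //= q IH x; rewrite IH. Qed.

Lemma bits_of_natK q x : x < 2 ^ q -> nat_of_bits (bits_of_nat q x) = x.
Proof.
elim: q x => [[]//|q IH] x xq /=; rewrite IH ?odd_double_half //.
by move: xq; rewrite expnS; have := odd_double_half x; lia.
Qed.

Lemma nat_of_bits_lt b : nat_of_bits b < 2 ^ size b.
Proof. by elim: b => //= c b IH; rewrite expnS; lia. Qed.

Lemma size_encode q s : size (encode q s) = size s * q.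
Proof. by elim: s => //= x s IH; rewrite size_cat IH size_bits_of_nat mulSn. Qed.

Lemma size_decode q m b : size (decode q m b) = m.
Proof. by elim: m b => //= m IH b; rewrite IH. Qed.

Lemma decode_lt q m b x : x \in decode q m b -> x < 2 ^ q.
Proof.
elim: m b => //= m IH b; rewrite inE => /orP[/eqP ->|/IH //].
apply: leq_trans (nat_of_bits_lt _) _; rewrite leq_exp2l // size_take_min.
exact: geq_minl.
Qed.

Lemma encodeK q s : {in s, forall x, x < 2 ^ q} -> decode q (size s) (encode q s) = s.
Proof.
elim: s => //= x s IH sq.
rewrite take_size_cat ?size_bits_of_nat // drop_size_cat ?size_bits_of_nat //.
rewrite bits_of_natK ?sq ?mem_head // IH // => y ys.
by apply: sq; rewrite inE ys orbT.
Qed.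

(** The public string is read as the table of a random function with values 0 to 3; the entry of a
    pair sits at its two-digit number in base [w]. *)
Definition pair_hash (w : nat) (r : bits) (x : nat * nat) : nat :=
  nth false r (x.1 * w + x.2).*2 + (nth false r (x.1 * w + x.2).*2.+1).*2.

Lemma pair_hash_le w r x : pair_hash w r x <= 3.
Proof. by rewrite /pair_hash; do 2 case: (nth _ _ _). Qed.

Lemma affine_inj (a b g h x y : nat) : a <> b ->
  a * x + g = b * x + h -> a * y + g = b * y + h -> x = y.
Proof.
wlog ab : a b g h / a < b => [W ne e1 e2|_].
  case: (ltngtP a b) ne => // lt ne; first exact: W ne e1 e2.
  exact: (W b a h g lt (nesym ne) (esym e1) (esym e2)).
rewrite -(subnKC (ltnW ab)) !mulnDl -!addnA => /addnI e1 /addnI e2.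
by apply/eqP; rewrite -(@eqn_pmul2l (b - a)) ?subn_gt0 // -(eqn_add2r h) -e1 -e2.
Qed.

(* Resampling the two bits that hash a pair of different multiplicity in [X]
   and [Y] yields at most one collision out of four. *)
Lemma hash_collisions (w : nat) (X Y : seq (nat * nat)) :
  {in X ++ Y, forall x, x.1 < w /\ x.2 < w} -> ~~ perm_eq X Y ->
  4 * #|[set r : ((w * w).*2).-tuple bool |
         \sum_(x <- X) pair_hash w r x == \sum_(x <- Y) pair_hash w r x]|
  <= 2 ^ (w * w).*2.
Proof.
move=> XYw /allPn[x0 x0XY /= ne].
set A := [set r | _]; set m := (w * w).*2.
pose code (x : nat * nat) := x.1 * w + x.2.
have code_lt x : x \in X ++ Y -> code x < w * w.
  by move/XYw => [x1 x2]; rewrite -[w * w]addn0; exact: ltn_digits.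
have code_inj x y : x \in X ++ Y -> y \in X ++ Y -> code x = code y -> x = y.
  move=> /XYw[x1 x2] /XYw[y1 y2]; rewrite /code => E.
  have w0 : 0 < w by lia.
  have := congr1 (divn^~ w) E; rewrite !divnMDl // !divn_small // !addn0 => E1.
  by rewrite (surjective_pairing x) (surjective_pairing y) E1; congr pair; move: E; rewrite E1 => /addnI.
have [X_XY Y_XY] : {subset X <= X ++ Y} /\ {subset Y <= X ++ Y}.
  by split=> x xX; rewrite mem_cat xX ?orbT.
pose c := (code x0).*2.
have cm : c.+1 < m by have := code_lt _ x0XY; rewrite /c /m; lia.
(* [f] overwrites the two bits hashing [x0]. On colliding strings it is injective, since a collision
   determines these bits from all the others; hence the factor 4. *)
pose f (z : m.-tuple bool * (bool * bool)) : m.-tuple bool :=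
  [tuple if i == c :> nat then z.2.1 else if i == c.+1 :> nat then z.2.2 else tnth z.1 i | i < m].
have fE z i : i < m -> nth false (f z) i =
    if i == c then z.2.1 else if i == c.+1 then z.2.2 else nth false z.1 i.
  move=> im; rewrite -[i]/(nat_of_ord (Ordinal im)) -tnth_nth tnth_mktuple /=.
  by rewrite (tnth_nth false).
have finj : {in setX A [set: bool * bool] &, injective f}.
  move=> [r s] [r' s']; rewrite !inE !andbT /= => rA r'A E.
  have E' i : i < m -> (if i == c then s.1 else if i == c.+1 then s.2 else nth false r i) =
    (if i == c then s'.1 else if i == c.+1 then s'.2 else nth false r' i).
    by move=> im; have := congr1 (fun t : m.-tuple bool => nth false t i) E; rewrite !fE.
  have s1 : s.1 = s'.1 by have := E' c (ltnW cm); rewrite eqxx.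
  have s2 : s.2 = s'.2.
    by have := E' c.+1 cm; rewrite eqxx (gtn_eqF (ltnSn c)).
  have rr i : i < m -> i != c -> i != c.+1 -> nth false r i = nth false r' i.
    by move=> im /negPf ic /negPf ic1; have := E' i im; rewrite ic ic1.
  have hh x : x \in X ++ Y -> x != x0 -> pair_hash w r x = pair_hash w r' x.
    move=> xXY xx0; rewrite /pair_hash -/(code x).
    have cx := code_lt x xXY.
    have ccx : code x != code x0 by apply: contra xx0 => /eqP /code_inj ->.
    by rewrite !rr // /c /m; lia.
  have split_sum (Z : seq (nat * nat)) (t : bits) :
      \sum_(x <- Z) pair_hash w t x =
      count_mem x0 Z * pair_hash w t x0 + \sum_(x <- Z | x != x0) pair_hash w t x.
    rewrite (bigID (pred1 x0)) /=; congr addn.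
    rewrite (eq_bigr (fun=> pair_hash w t x0)) => [|x /eqP -> //].
    by rewrite big_const_seq iter_addn_0 mulnC.
  have rest (Z : seq (nat * nat)) : {subset Z <= X ++ Y} ->
      \sum_(x <- Z | x != x0) pair_hash w r x = \sum_(x <- Z | x != x0) pair_hash w r' x.
    move=> ZXY; rewrite big_seq_cond [RHS]big_seq_cond; apply: eq_bigr => x /andP[xZ xx0].
    exact: hh (ZXY _ xZ) xx0.
  move: rA r'A; rewrite !split_sum (rest X) // (rest Y) // => /eqP e1 /eqP e2.
  have h0 : pair_hash w r x0 = pair_hash w r' x0 by move/eqP: ne => ne; exact: affine_inj ne e1 e2.
  have [b1 b2] : nth false r c = nth false r' c /\ nth false r c.+1 = nth false r' c.+1.
    move: h0; rewrite /pair_hash -/(code x0) -/c.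
    by do 4 case: (nth false _ _).
  congr pair; last by rewrite (surjective_pairing s) s1 s2 -surjective_pairing.
  apply/val_inj/(@eq_from_nth _ false); rewrite !size_tuple // => i im.
  by have [->//|ic] := eqVneq i c; have [->//|ic1] := eqVneq i c.+1; exact: rr.
have := card_in_imset finj; rewrite cardsX cardsT card_prod card_bool mulnC => <-.
by rewrite (leq_trans (max_card _)) // card_tuple card_bool.
Qed.

Definition next_state (x : nat * nat * bool) : nat * nat := (x.1.1.+1, x.1.2 + x.2).

(* Along the path of states [(p, l)], the second component counts the marked
   steps; a multiset of steps is a path as soon as it balances at every state. *)
Lemma balanced_steps (St : seq (nat * nat * bool)) (K L : nat) :
  perm_eq ((0, 0) :: [seq next_state x | x <- St])
          ((K, L) :: [seq x.1 | x <- St]) ->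
  uniq [seq x.1.1 | x <- St] /\
  {in St, forall x, x.1.1 = count (fun y => y.1.1 < x.1.1) St /\
                    x.1.2 = count (fun y => y.2 && (y.1.1 < x.1.1)) St}.
Proof.
move=> pe; pose c t := count (fun y : nat * nat * bool => y.1.1 == t) St.
have cE t : (0 == t) + count (fun y : nat * nat * bool => y.1.1.+1 == t) St = (K == t) + c t.
  have := permP pe (fun y => y.1 == t).
  by rewrite /= !count_map /=.
(* Position [t.+1] is entered only from [t], and position 0 only by the initial state, so
   multiplicities never exceed one. *)
have c1 t : c t <= 1.
  elim: t => [|t IH]; first by have := cE 0; rewrite /= -[count _ St]/(count xpred0 St) count_pred0; lia.
  have := cE t.+1; rewrite [0 == _]/= add0n.
  by under eq_count => y do rewrite eqSS; rewrite -/(c t); lia.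
have U : uniq [seq x.1.1 | x <- St].
  apply: count_mem_uniq => t; rewrite count_map -[count _ _]/(c t).
  have := c1 t; rewrite -has_pred1 has_count count_map -[count _ _]/(c t).
  by case: (c t) => [|[]].
have same x y : x \in St -> y \in St -> x.1.1 = y.1.1 -> x = y.
  move=> xS yS E; apply/eqP; have := c1 y.1.1; rewrite /c.
  rewrite -size_filter; case F: [seq _ <- _ | _] => [|a [|]] // _.
    by have : x \in [::] by rewrite -F mem_filter E eqxx.
  have : x \in [:: a] by rewrite -F mem_filter E eqxx.
  have : y \in [:: a] by rewrite -F mem_filter eqxx.
  by rewrite !inE => /eqP -> /eqP ->.
have cx x : x \in St -> c x.1.1 = 1.
  by move=> xS; apply/eqP; rewrite eqn_leq c1 -has_count; apply/hasP; exists x.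
split=> //.
have H t x : x \in St -> x.1.1 = t -> x.1.1 = count (fun y => y.1.1 < x.1.1) St /\
                    x.1.2 = count (fun y => y.2 && (y.1.1 < x.1.1)) St.
  elim: t x => [|t IH] x xS xt.
    have : x.1 \in (0, 0) :: [seq next_state x | x <- St].
      by rewrite (perm_mem pe) inE map_f ?orbT.
    rewrite inE => /orP[/eqP x0|/mapP[y _ x0]]; last by rewrite x0 in xt.
    rewrite x0 /=; split; apply/esym/eqP.
      by rewrite -[count _ _]/(count xpred0 St) count_pred0.
    by rewrite (eq_count (a2 := xpred0)) ?count_pred0 // => y /=; rewrite ltn0 andbF.
  have : x.1 \in (0, 0) :: [seq next_state x | x <- St].
    by rewrite (perm_mem pe) inE map_f ?orbT.
  rewrite inE => /orP[/eqP x0|/mapP[y yS x0]]; first by rewrite x0 in xt.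
  have yt : y.1.1 = t by move: xt; rewrite x0 => -[].
  have [y1 y2] := IH y yS yt.
  (* Raising the threshold by one admits only steps at position [y.1.1], and by uniqueness that is
     [y] alone. *)
  have CS (P : pred (nat * nat * bool)) : count (fun z => P z && (z.1.1 < y.1.1.+1)) St =
      count (fun z => P z && (z.1.1 < y.1.1)) St + P y.
    have -> : nat_of_bool (P y) = count (fun z => P z && (z.1.1 == y.1.1)) St.
      rewrite (@eq_in_count _ _ (fun z => P y && (z.1.1 == y.1.1))) => [|z zS].
        by case: (P y); [rewrite -[RHS]/(c y.1.1) cx | rewrite count_pred0].
      by have [/eqP E|] := boolP (z.1.1 == y.1.1); rewrite ?andbF // (same z y).
    by elim: (St) => //= z s ->; rewrite ltnS; case: (P z) => //; case: (ltngtP z.1.1 y.1.1) => _ /=; lia.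
  rewrite x0 /=; split.
    by have := CS xpredT; rewrite /= -y1 => ->; rewrite addn1.
  by rewrite CS -y2.
by move=> x xS; exact: (H x.1.1).
Qed.

(** * Balanced gaps *)

Definition inside (a b : nat) (s : seq nat) : nat := count (fun x => a < x < b) s.

(* [l] lists, for each slot of [p], the number of smaller leading slots; when
   slots are numbered consecutively, the equation says that the non-neighbours
   have exactly [k] times as many slots as leading slots in the gap [(a, b)]. *)
Definition gap_check (k : nat) (p l : seq nat) (ys : seq (seq nat)) : bool :=
  all (fun i => let a := nth 0 p i in let b := nth 0 p i.+1 in
         k * nth 0 l i.+1 + a.+1 + \sum_(y <- ys) inside a b y
         == k * (nth 0 l i + (i == 0)) + b + k * \sum_(y <- ys) (a < head 0 y < b))
      (iota 0 k.-1).

Section Gaps.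
Variables (k n : nat) (e : rel 'I_n) (S : 'I_n -> seq nat).
Hypotheses (k_gt0 : 0 < k) (e_irr : irreflexive e) (e_sym : symmetric e).
Hypotheses (S_size : forall v, size (S v) = k) (S_sorted : forall v, sorted ltn (S v)).
Hypothesis S_disj : forall u v x, x \in S u -> x \in S v -> u = v.

Let p v i := nth 0 (S v) i.

Lemma slot_mem v i : i < k -> p v i \in S v.
Proof. by move=> ik; rewrite mem_nth ?S_size. Qed.

Lemma slot_ltn v i j : i < k -> j < k -> (p v i < p v j) = (i < j).
Proof.
have lt i1 j1 : i1 < k -> j1 < k -> i1 < j1 -> p v i1 < p v j1.
  by move=> ik jk; apply: (sorted_ltn_nth ltn_trans 0 (S_sorted v)); rewrite inE S_size.
move=> ik jk; case: (ltngtP i j) => [ij|ji|->]; [exact: lt | | exact: ltnn].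
by apply/negbTE; rewrite -leqNgt ltnW // lt.
Qed.

Lemma slotP v x : reflect (exists2 i, i < k & x = p v i) (x \in S v).
Proof.
apply: (iffP (nthP 0)) => -[i]; rewrite ?S_size => ik.
  by move=> <-; exists i.
by move=> ->; exists i; rewrite ?S_size.
Qed.

Lemma head_slot v : head 0 (S v) = p v 0.
Proof. by rewrite /p nth0. Qed.

Lemma head_slot_le v x : x \in S v -> p v 0 <= x.
Proof.
by move=> /slotP[[|i] ik ->] //; rewrite ltnW // slot_ltn.
Qed.

Lemma slot_between v x i : i.+1 < k -> x \in S v -> (p v i < x < p v i.+1) = false.
Proof.
move=> ik /slotP[j jk ->]; rewrite !slot_ltn //; last exact: ltnW.
by rewrite ltnS; case: ltngtP.
Qed.

Lemma gap_meets v w a b x y : a \in S v -> b \in S v -> x \in S w -> y \in S w ->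
  a < b -> a < x < b -> (y < a) || (b < y) -> meets ltn (S v) (S w).
Proof.
move=> av bv xw yw ab /andP[ax xb] /orP[ya|yb]; apply/orP; [right|left]; apply/interleaveP.
  by exists y, a, x, b.
by exists a, x, b, y.
Qed.

Lemma inside_gap_nonmeeting v w i : i.+1 < k -> w != v -> ~~ meets ltn (S v) (S w) ->
  inside (p v i) (p v i.+1) (S w) = k * (p v i < p w 0 < p v i.+1).
Proof.
move=> ik wv nm; set a := p v i; set b := p v i.+1.
have av : a \in S v by apply: slot_mem; exact: ltnW.
have bv : b \in S v by exact: slot_mem.
have ab : a < b by rewrite slot_ltn //; exact: ltnW.
have ne c x : c \in S v -> x \in S w -> x != c.
  by move=> cv xw; apply: contra wv => /eqP E; apply/eqP; apply: (@S_disj w v x); rewrite // E.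
have h0 : p w 0 \in S w by exact: slot_mem.
have [hab|hab] := boolP (a < p w 0 < b); rewrite ?muln1 ?muln0.
  rewrite -(S_size w); apply/eqP; rewrite -all_count; apply/allP => x xw.
  apply: contraR nm => nab; apply: (gap_meets av bv h0 xw) => //.
  have := ne a x av xw; have := ne b x bv xw; lia.
apply/eqP; rewrite -leqn0 leqNgt -has_count; apply/hasP => -[x xw xab].
case/negP: nm; apply: (gap_meets av bv xw h0) => //.
have := ne a _ av h0; have := ne b _ bv h0; lia.
Qed.

(* A crossing non-neighbouring pair whose later polygon starts earliest would
   be alone responsible for an imbalance in the gap where that polygon starts. *)
Lemma balanced_gaps_nonmeeting :
  (forall v i, i.+1 < k ->
     k * \sum_(w | (w != v) && ~~ e v w) (p v i < p w 0 < p v i.+1) =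
     \sum_(w | (w != v) && ~~ e v w) inside (p v i) (p v i.+1) (S w)) ->
  forall u v, u != v -> ~~ e u v -> ~~ meets ltn (S u) (S v).
Proof.
move=> bal.
pose bad (z : 'I_n * 'I_n) := [&& z.1 != z.2, ~~ e z.1 z.2, meets ltn (S z.1) (S z.2) & p z.1 0 < p z.2 0].
have ne u v x y : u != v -> x \in S u -> y \in S v -> x != y.
  by move=> uv xu yv; apply: contra uv => /eqP E; apply/eqP; apply: (@S_disj u v x); rewrite // E.
have h0 w : p w 0 \in S w by exact: slot_mem.
suff nobad z : ~~ bad z.
  move=> u v uv nuv; apply/negP => m.
  have := ne u v _ _ uv (h0 u) (h0 v); case: ltngtP => // lt _.
    by have := nobad (u, v); rewrite /bad /= uv nuv m lt.
  by have := nobad (v, u); rewrite /bad /= eq_sym uv e_sym nuv meetsC m lt.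
apply/negP => z0.
case: (arg_minnP (fun z : 'I_n * 'I_n => p z.2 0) z0) => -[v w] /= /and4P[/= vw nvw m vw0] minw.
have minw' u u' : u != u' -> ~~ e u u' -> meets ltn (S u) (S u') -> p u 0 < p u' 0 -> p w 0 <= p u' 0.
  by move=> uu nu mu lt; apply: (minw (u, u')); apply/and4P.
(* If the first slot of [w] is in no gap of [v], it comes after every slot of [v], because [v]
   starts earlier; then no alternation is possible. *)
have [|noa] := boolP [exists i : 'I_k, (i.+1 < k) && (p v i < p w 0 < p v i.+1)]; last first.
  have last_lt : p v k.-1 < p w 0.
    have H i : i < k -> p v i < p w 0.
      elim: i => [//|i IH] ik; have := IH (ltnW ik) => lti.
      have := existsPn noa (Ordinal (ltnW ik)); rewrite /= ik lti /=.
      by have := ne w v _ _ _ (h0 w) (slot_mem v ik); rewrite eq_sym vw => /(_ isT); lia.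
    by apply: H; rewrite prednK.
  have all_lt x : x \in S v -> x < p w 0.
    move=> /slotP[i ik ->]; apply: leq_ltn_trans last_lt.
    by rewrite leqNgt slot_ltn ?prednK // -ltnNge.
  by case/orP: m => /interleaveP[a [b [c [d [[]]]]]] => [av bw cv dw [ab bc _]|aw bv cw dv [ab bc cd]];
    [have := all_lt c cv; have := head_slot_le bw | have := all_lt b bv; have := head_slot_le aw]; lia.
move=> /existsP[i /andP[ik gap]].
set a := p v i in gap *; set b := p v i.+1 in gap *.
have av : a \in S v by apply: slot_mem; exact: ltnW.
have bv : b \in S v by exact: slot_mem.
have ab : a < b by rewrite slot_ltn //; exact: ltnW.
(* A non-neighbour with a slot in the gap that does not start there starts before [a], hence crosses
   [v]; both starts precede [p w 0], against minimality. *)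
have le u : (u != v) && ~~ e v u -> inside a b (S u) <= k * (a < p u 0 < b).
  move=> /andP[uv nuv]; case: (boolP (a < p u 0 < b)) => hu.
    by rewrite muln1 -(S_size u) count_size.
  rewrite muln0 leqNgt -has_count; apply/hasP => -[x xu /andP[ax xb]].
  have mu : meets ltn (S v) (S u).
    apply: (gap_meets av bv xu (h0 u)) => //; first by rewrite ax.
    have := ne u v _ _ uv (h0 u) av; have := head_slot_le xu; lia.
  have ua : p u 0 < a.
    by have := ne u v _ _ uv (h0 u) av; have := head_slot_le xu; lia.
  have := ne u v _ _ uv (h0 u) (h0 v); case: ltngtP => // lt _.
    by have := minw' u v; rewrite e_sym meetsC => /(_ uv nuv mu lt); lia.
  by have := minw' v u; rewrite eq_sym => /(_ uv nuv mu lt); lia.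
have wv : (w != v) && ~~ e v w by rewrite eq_sym vw nvw.
have := bal v i ik; rewrite big_distrr /=.
rewrite (bigD1 w wv) [RHS](bigD1 w wv) /= -/a -/b => E.
have le_rest : \sum_(u | ((u != v) && ~~ e v u) && (u != w)) inside a b (S u) <=
    \sum_(u | ((u != v) && ~~ e v u) && (u != w)) k * (a < p u 0 < b).
  by apply: leq_sum => u /andP[/le].
(* As no other term exceeds its share, equality forces all [k] slots of [w] into a gap free of slots
   of [v], so the two cannot cross. *)
have /eqP all_in : inside a b (S w) == size (S w).
  rewrite eqn_leq count_size S_size /=; move: E le_rest; rewrite gap muln1.
  by set X := bigop _ _ _; set Y := bigop _ _ _; lia.
move: all_in; rewrite /inside => /eqP; rewrite -all_count => /allP all_in.
case/orP: m => /interleaveP[x [y [x' [y' [[]]]]]].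
  move=> xv yw x'v y'w [/= xy yx xy']; have := slot_between ik x'v.
  by have := all_in _ yw; have := all_in _ y'w; rewrite -/a -/b; lia.
move=> xw yv x'w y'v [/= xy yx xy']; have := slot_between ik yv.
by have := all_in _ xw; have := all_in _ x'w; rewrite -/a -/b; lia.
Qed.

Definition label x := \sum_w (p w 0 < x).

(** With consecutive numbering, [b - a - 1] counts all slots in the gap, and the label difference
    counts all leading slots there, plus [a] itself when [i == 0]. The node has no slot in its own
    gap, so subtracting the neighbours leaves the non-neighbours. *)
Lemma gap_check_balance v (l : seq nat) (ys : seq (seq nat)) :
  (forall u x, x \in S u -> x = \sum_w count (fun y => y < x) (S w)) ->
  (forall i, i < k -> nth 0 l i = label (p v i)) ->
  perm_eq ys [seq S w | w <- enum 'I_n & e v w] ->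
  reflect (forall i, i.+1 < k ->
     k * \sum_(w | (w != v) && ~~ e v w) (p v i < p w 0 < p v i.+1) =
     \sum_(w | (w != v) && ~~ e v w) inside (p v i) (p v i.+1) (S w))
    (gap_check k (S v) l ys).
Proof.
move=> num lE yse.
have sumE (F : seq nat -> nat) : \sum_(y <- ys) F y = \sum_(w | (w != v) && e v w) F (S w).
  rewrite (perm_big _ yse) big_map big_filter big_enum_cond /=; apply: eq_bigl => w.
  by case: eqP => [->|]; rewrite ?e_irr.
have splitE (F : 'I_n -> nat) : F v = 0 -> \sum_w F w =
    \sum_(w | (w != v) && e v w) F w + \sum_(w | (w != v) && ~~ e v w) F w.
  by move=> Fv; rewrite (bigD1 v) //= Fv (bigID (e v)).
have step i : i.+1 < k ->
    (k * nth 0 l i.+1 + (p v i).+1 + \sum_(y <- ys) inside (p v i) (p v i.+1) y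
      == k * (nth 0 l i + (i == 0)) + p v i.+1 + k * \sum_(y <- ys) (p v i < head 0 y < p v i.+1)) =
    (k * \sum_(w | (w != v) && ~~ e v w) (p v i < p w 0 < p v i.+1) ==
     \sum_(w | (w != v) && ~~ e v w) inside (p v i) (p v i.+1) (S w)).
  move=> ik; have ik' := ltnW ik; set a := p v i; set b := p v i.+1.
  have av : a \in S v by exact: slot_mem.
  have ab : a < b by rewrite slot_ltn.
  have bE : b = a.+1 + \sum_w inside a b (S w).
    rewrite {1}(num v b (slot_mem v ik)).
    have -> : \sum_w count (fun y => y < b) (S w) =
        \sum_w count (fun y => y < a) (S w) + \sum_w (a \in S w) + \sum_w inside a b (S w).
      rewrite -!big_split; apply: eq_bigr => w _ /=.
      have U : uniq (S w) by exact: (sorted_uniq ltn_trans ltnn).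
      rewrite -(count_uniq_mem a U) /inside.
      by elim: (S w) => //= x s ->; case: (ltngtP x a) => /=; case: (ltngtP x b) => /=; lia.
    rewrite -(num v a av) (bigD1 v) //= av big1 ?addn0 ?addn1 // => w wv.
    by apply/eqP; rewrite eqb0; apply: contra wv => aw; apply/eqP/(S_disj aw av).
  have lb : label b = label a + (i == 0) + \sum_w (a < p w 0 < b).
    have -> : nat_of_bool (i == 0) = \sum_w (a == p w 0).
      rewrite (bigD1 v) //= big1 ?addn0 => [|w wv].
        rewrite /a; case: (i) ik' => [|j] jk; first by rewrite !eqxx.
        have lt : p v 0 < p v j.+1 by rewrite slot_ltn.
        by rewrite (gtn_eqF lt).
      apply/eqP; rewrite eqb0; apply: contra wv => /eqP E.
      by apply/eqP/(@S_disj w v a) => //; rewrite E slot_mem.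
    rewrite /label -!big_split; apply: eq_bigr => w _ /=.
    by case: (ltngtP (p w 0) a) => /=; case: (ltngtP (p w 0) b) => /=; lia.
  rewrite splitE in bE; last first.
    by apply/eqP; rewrite -leqn0 leqNgt -has_count; apply/hasP => -[x /(slot_between ik) ->].
  rewrite splitE in lb; last by rewrite (slot_between ik (slot_mem v k_gt0)).
  have headE : \sum_(w | (w != v) && e v w) (a < head 0 (S w) < b) =
      \sum_(w | (w != v) && e v w) (a < p w 0 < b).
    by apply: eq_bigr => w _; rewrite head_slot.
  rewrite !sumE /= headE !lE // -/a -/b; move: bE lb.
  move: (label a) (label b) => la lb; clearbody a b.
  move: (\sum_(w | _ && e _ _) (_ < _ < _)) (\sum_(w | _ && ~~ e _ _) (_ < _ < _)) => F1 F2.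
  move: (\sum_(w | _ && e _ _) _) (\sum_(w | _ && ~~ e _ _) _) => C1 C2 -> ->.
  by rewrite !mulnDr; apply/eqP/eqP; lia.
apply: (iffP allP) => [H i ik|H i].
  by apply/eqP; rewrite -step //; apply: H; rewrite mem_iota /= add0n; lia.
by rewrite mem_iota add0n /= => ik; rewrite step ?H //; lia.
Qed.

End Gaps.

(** * Aggregation along parent pointers and local checks *)

Lemma spanning_parents (T : finType) (e : rel T) (root : T) :
  (forall u v, connect e u v) ->
  exists (par : T -> T) (dist : T -> nat), (forall v, dist v < #|T|) /\
    forall v, v != root -> e v (par v) /\ dist (par v) < dist v.
Proof.
move=> conn.
have reach v : exists m, [exists p : m.-tuple T, path e v p && (last v p == root)].
  have /connectP[p ep ->] := conn v root.
  by exists (size p); apply/existsP; exists (in_tuple p); rewrite ep eqxx.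
pose dist v := ex_minn (reach v).
have dist_le v p : path e v p -> last v p = root -> dist v <= size p.
  move=> ep lp; rewrite /dist; case: ex_minnP => m _; apply.
  by apply/existsP; exists (in_tuple p); rewrite ep lp eqxx.
have step v : exists u, (v != root) ==> e v u && (dist u < dist v).
  have [_|vr] := eqVneq v root; first by exists v.
  have : [exists p : (dist v).-tuple T, path e v p && (last v p == root)].
    by rewrite /dist; case: ex_minnP.
  case/existsP => -[[|u p] /= /eqP sp].
    by move=> /eqP vE; rewrite vE eqxx in vr.
  move=> /andP[/andP[evu eup] /eqP lp]; exists u; rewrite evu -sp /= ltnS.
  exact: dist_le.
exists (fun v => xchoose (step v)), dist; split=> v; last first.
  by move=> vr; have /implyP/(_ vr)/andP[] := xchooseP (step v).
have /connectP[p ep] := conn v root; case/shortenP: ep => p' ep' U _ lp'.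
apply: leq_trans (max_card (mem (v :: p'))); rewrite (card_uniqP U) ltnS.
exact: dist_le.
Qed.

(** The recurrence is iterated [n] times from zero: children have larger [dist], so values become
    final from the deepest nodes upwards. Each round adds at most the total of [a], a crude bound
    that still costs only logarithmically many bits. *)
Lemma subtree_sums (n : nat) (par : 'I_n -> 'I_n) (dist : 'I_n -> nat) (root : 'I_n) :
  (forall v, dist v < n) -> (forall v, v != root -> dist (par v) < dist v) ->
  exists s : ('I_n -> nat) -> 'I_n -> nat, forall a,
    (forall v, s a v = a v + \sum_(u | (u != root) && (par u == v)) s a u) /\
    (forall v, s a v <= n * \sum_u a u).
Proof.
move=> distn dpar.
pose next a (s : 'I_n -> nat) v := a v + \sum_(u | (u != root) && (par u == v)) s u.
pose s j a := iter j (next a) (fun=> 0).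
exists (s n) => a.
have stable j v : n <= j + dist v -> s j.+1 a v = s j a v.
  elim: j v => [|j IH] v; first by rewrite add0n leqNgt distn.
  move=> le; congr addn; apply: eq_bigr => u /andP[ur /eqP uv].
  apply: IH; apply: leq_trans le _; rewrite addSnnS leq_add2l -uv; exact: dpar.
have total j : \sum_v s j a v <= j * \sum_u a u.
  elim: j => [|j IH]; first by rewrite big1.
  rewrite mulSn [X in X <= _]big_split leq_add2l; apply: leq_trans IH.
  rewrite [X in _ <= X](bigID (fun u => u != root)) /=.
  by rewrite [X in _ <= X + _](partition_big par xpredT) //= leq_addr.
split=> v; first by rewrite -{1}stable ?leq_addr.
by apply: leq_trans (total n); rewrite (bigD1 v) //= leq_addr.
Qed.

(** Double counting: in the sum of all local equations each non-root value occurs once on either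
    side and cancels. Values on a cycle of pointers cancel too, so no acyclicity is required. *)
Lemma children_total (T : finType) (is_root : pred T) (child : rel T) (a s : T -> nat) :
  (forall u, \sum_v child v u = ~~ is_root u) ->
  (forall v, s v = a v + \sum_(u | child v u) s u) ->
  \sum_(v | is_root v) s v = \sum_v a v.
Proof.
move=> ch sE; apply/eqP; rewrite -(eqn_add2r (\sum_(v | ~~ is_root v) s v)).
rewrite -(bigID is_root xpredT s (r := index_enum T)) /=; apply/eqP; rewrite [LHS](eq_bigr _ (fun v _ => sE v)) big_split; congr addn.
under eq_bigr do rewrite big_mkcond.
rewrite exchange_big [RHS]big_mkcond; apply: eq_bigr => u _ /=.
transitivity ((\sum_v child v u) * s u); last by rewrite ch; case: (is_root u); rewrite ?mul1n.
by rewrite big_distrl; apply: eq_bigr => v _ /=; case: (child v u); rewrite ?mul1n.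
Qed.

Definition steps (p l : seq nat) : seq (nat * nat * bool) :=
  [seq (nth 0 p i, nth 0 l i, i == 0) | i <- iota 0 (size p)].

Lemma slots_steps p l : [seq x.1.1 | x <- steps p l] = p.
Proof.
by rewrite -map_comp -[RHS](mkseq_nth 0).
Qed.

Lemma count_steps p l (P : pred nat) :
  count (fun x => P x.1.1) (steps p l) = count P p.
Proof. by rewrite -[in RHS](slots_steps p l) count_map. Qed.

Lemma count_first_step p l t : 0 < size p ->
  count (fun x => x.2 && (x.1.1 < t)) (steps p l) = (nth 0 p 0 < t).
Proof.
case: p => //= x p _; rewrite -[RHS]addn0; congr addn.
rewrite count_map (@eq_in_count _ _ xpred0) ?count_pred0 // => -[|i] /=; last by [].
by rewrite mem_iota.
Qed.

(** Used only at the root. The honest prover roots the tree at the owner of the last slot, where the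
    end of the path is locally known; soundness accepts any end state. *)
Definition final_state (p l : seq nat) : nat * nat :=
  next_state (last (0, 0, false) (steps p l)).

Section Verifier.
Variable k : nat.

(* The identifier of a node, the decoded first certificate
   [root, parent, slots, labels], and the decoded second certificate holding
   two hash sums over the subtree of the node. *)
Definition info := (nat * seq nat * seq nat)%type.

Definition root_of (s : seq nat) := nth 0 s 0.
Definition parent_of (s : seq nat) := nth 0 s 1.
Definition slots_of (s : seq nat) := take k (drop 2 s).
Definition labels_of (s : seq nat) := drop k (drop 2 s).
Definition steps_of (s : seq nat) := steps (slots_of s) (labels_of s).

Definition is_child (x y : info) : bool :=
  (parent_of y.1.2 == x.1.1) && (y.1.1 != root_of y.1.2).

(** Involves neither the random string nor the second certificate, so acceptance for a single string
    establishes it for good. *)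
Definition static_check (x : nat * seq nat) (ys : seq (nat * seq nat)) : bool :=
  [&& sorted ltn (slots_of x.2),
      all (fun y => root_of y.2 == root_of x.2) ys,
      all (fun y => meets ltn (slots_of x.2) (slots_of y.2)) ys,
      gap_check k (slots_of x.2) (labels_of x.2) [seq slots_of y.2 | y <- ys] &
      (x.1 == root_of x.2) || has (fun y => y.1 == parent_of x.2) ys].

Definition hash_check (w : nat) (r : bits) (x : info) (ys : seq info) : bool :=
  let h := pair_hash w r in
  let st := steps_of x.1.2 in
  [&& nth 0 x.2 0 == \sum_(z <- st) h (next_state z) + \sum_(y <- ys | is_child x y) nth 0 y.2 0,
      nth 0 x.2 1 == \sum_(z <- st) h z.1 + \sum_(y <- ys | is_child x y) nth 0 y.2 1 &
      (x.1.1 == root_of x.1.2) ==>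
        (h (0, 0) + nth 0 x.2 0 ==
         h (final_state (slots_of x.1.2) (labels_of x.1.2)) + nth 0 x.2 1)].

Definition local_check (w : nat) (r : bits) (x : info) (ys : seq info) : bool :=
  static_check x.1 [seq y.1 | y <- ys] && hash_check w r x ys.

End Verifier.

(** * Soundness *)

Lemma uniq_flatten_eq (I : eqType) (T : eqType) (S : I -> seq T) (r : seq I) u v x :
  uniq (flatten [seq S i | i <- r]) -> u \in r -> v \in r ->
  x \in S u -> x \in S v -> u = v.
Proof.
have sub s w : w \in s -> {subset S w <= flatten [seq S i | i <- s]}.
  by move=> ws y yw; apply/flatten_mapP; exists w.
elim: r => //= i r IH; rewrite cat_uniq => /and3P[_ /hasPn ni U].
rewrite !inE => /orP[/eqP ->|ur] /orP[/eqP ->|vr] // xu xv; last exact: IH.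
  by have := ni x (sub r v vr x xv); rewrite /= xu.
by have := ni x (sub r u ur x xu); rewrite /= xv.
Qed.

Lemma count_flatten_map (I T : Type) (P : pred T) (S : I -> seq T) (r : seq I) :
  count P (flatten [seq S i | i <- r]) = \sum_(i <- r) count P (S i).
Proof. by elim: r => [|i r IH]; rewrite ?big_nil //= big_cons count_cat IH. Qed.

Lemma eq_connected (T : finType) (T' : Type) (e : rel T) (f : T -> T') :
  (forall u v, e u v -> f u = f v) -> forall u v, connect e u v -> f u = f v.
Proof.
move=> ef u v /connectP[p + ->]; elim: p u => //= w p IH u /andP[/ef -> ep].
exact: IH.
Qed.

Section States.
Variables (k n : nat) (id : 'I_n -> nat) (c : 'I_n -> seq nat).

Definition all_steps := flatten [seq steps_of k (c v) | v <- enum 'I_n].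

Definition is_root (v : 'I_n) := id v == root_of (c v).

Definition left_states : seq (nat * nat) :=
  [seq (0, 0) | v <- enum 'I_n & is_root v] ++ [seq next_state z | z <- all_steps].

Definition right_states : seq (nat * nat) :=
  [seq final_state (slots_of k (c v)) (labels_of k (c v)) | v <- enum 'I_n & is_root v]
    ++ [seq z.1 | z <- all_steps].

End States.

Section Soundness.
Variables (k n : nat) (e : rel 'I_n) (id : 'I_n -> nat) (nb : 'I_n -> seq 'I_n).
Hypotheses (k_gt0 : 0 < k) (n_gt0 : 0 < n).
Hypotheses (e_sym : symmetric e) (e_irr : irreflexive e) (e_conn : forall u v, connect e u v).
Hypothesis id_inj : injective id.
Hypothesis nbE : forall v, perm_eq (nb v) [seq u <- enum 'I_n | e v u].
Variable c : 'I_n -> seq nat.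
Hypothesis c_size : forall v, size (c v) = 2 * k + 2.
Hypothesis static : forall v,
  static_check k (id v, c v) [seq (id u, c u) | u <- nb v].

Let S v := slots_of k (c v).
Let lab v := labels_of k (c v).

Lemma mem_nb v u : (u \in nb v) = e v u.
Proof. by rewrite (perm_mem (nbE v)) mem_filter mem_enum andbT. Qed.

Lemma size_slots v : size (S v) = k.
Proof. by rewrite /S /slots_of size_takel // size_drop c_size; lia. Qed.

Lemma root_constant u v : root_of (c u) = root_of (c v).
Proof.
apply: (eq_connected (f := fun v => root_of (c v))) (e_conn u v) => x y exy.
have /and5P[_ /allP rt _ _ _] := static x.
have := rt (id y, c y); rewrite map_f ?mem_nb // => /(_ isT) /eqP -> //.
Qed.

Lemma root_unique u v : is_root id c u -> is_root id c v -> u = v.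
Proof. by move=> /eqP iu /eqP iv; apply: id_inj; rewrite iu iv; exact: root_constant. Qed.

Lemma roots_le1 : [seq v <- enum 'I_n | is_root id c v] = [::] \/
  exists v, [seq v <- enum 'I_n | is_root id c v] = [:: v].
Proof.
case F: [seq _ <- _ | _] => [|u [|v s]]; [by left|by right; exists u|].
have U : uniq [seq v <- enum 'I_n | is_root id c v] by rewrite filter_uniq ?enum_uniq.
have m w : w \in [:: u, v & s] -> is_root id c w.
  by rewrite -F mem_filter => /andP[].
move: U; rewrite F /= inE (@root_unique u v) ?m ?inE ?eqxx ?orbT //.
Qed.

Lemma all_stepsE : [seq z.1.1 | z <- all_steps k c] = flatten [seq S v | v <- enum 'I_n].
Proof.
rewrite map_flatten -map_comp; congr flatten; apply: eq_map => v /=.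
exact: slots_steps.
Qed.

Lemma sound_states : perm_eq (left_states k id c) (right_states k id c) ->
  k_polygon_circle k e.
Proof.
rewrite /left_states /right_states; case: roots_le1 => [->|[r ->]] /= pe.
  (* Without a root there are no end points, and passing to successors raises the sum of the
     positions by the number [k * n] of steps, which is positive. *)
  have := perm_sumn (perm_map fst pe); rewrite -!map_comp => E.
  have : sumn [seq z.1.1.+1 | z <- all_steps k c] = sumn [seq z.1.1 | z <- all_steps k c] by [].
  have -> (s : seq (nat * nat * bool)) : sumn [seq z.1.1.+1 | z <- s] = sumn [seq z.1.1 | z <- s] + size s.
    by elim: s => //= z s ->; lia.
  have -> : size (all_steps k c) = size (flatten [seq S v | v <- enum 'I_n]).
    by rewrite -all_stepsE size_map.
  rewrite size_flatten /shape -map_comp (eq_map size_slots).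
  have -> : sumn [seq k | _ <- enum 'I_n] = k * n.
    rewrite -[in RHS](size_enum_ord n); elim: (enum _) => [|v s /= ->]; first by rewrite muln0.
    by rewrite mulnS.
  by nia.
move: pe; case: (final_state _ _) => K L /balanced_steps[U num].
rewrite all_stepsE in U.
have memS v i : i < k -> (nth 0 (S v) i, nth 0 (lab v) i, i == 0) \in all_steps k c.
  move=> ik; apply/flatten_mapP; exists v; first by rewrite mem_enum.
  by apply/mapP; exists i; rewrite // mem_iota size_slots.
have S_sorted v : sorted ltn (S v) by case/and5P: (static v).
have S_disj u v x : x \in S u -> x \in S v -> u = v.
  by apply: (uniq_flatten_eq U); rewrite mem_enum.
have S_num u x : x \in S u -> x = \sum_w count (fun y => y < x) (S w).
  move=> /(nthP 0)[i]; rewrite size_slots => ik <-.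
  have [/= E _] := num _ (memS u i ik).
  rewrite [LHS]E count_flatten_map big_enum /=; apply: eq_bigr => w _.
  exact: (count_steps _ _ (fun y => y < _)).
have labE v i : i < k -> nth 0 (lab v) i = label S (nth 0 (S v) i).
  move=> ik; have [/= _ ->] := num _ (memS v i ik).
  rewrite count_flatten_map big_enum /=.
  by apply: eq_bigr => w _; rewrite count_first_step ?size_slots.
apply: (@slots_polygons k n e S) => //.
- exact: size_slots.
- by move=> u v uv; apply/hasPn => x xu; apply: contra uv => xv; apply/eqP/(S_disj _ _ x).
move=> u v uv; apply/idP/idP => [euv|].
  have /and5P[_ _ /allP mt _ _] := static u.
  by have := mt (id v, c v); rewrite map_f ?mem_nb // => /(_ isT).
apply: contraLR => neuv.
apply: (balanced_gaps_nonmeeting k_gt0 e_sym size_slots S_sorted S_disj _ uv neuv).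
move=> w; have ysE := perm_map S (nbE w).
apply/(gap_check_balance k_gt0 e_irr size_slots S_sorted S_disj S_num (labE w) ysE).
by have /and5P[_ _ _] := static w; rewrite -map_comp.
Qed.

Lemma sound_hash (w : nat) (r : bits) (t : 'I_n -> seq nat) :
  (forall v, hash_check k w r (id v, c v, t v) [seq (id u, c u, t u) | u <- nb v]) ->
  \sum_(x <- left_states k id c) pair_hash w r x =
  \sum_(x <- right_states k id c) pair_hash w r x.
Proof.
move=> hc.
pose child (v u : 'I_n) := e v u && is_child (id v, c v, t v) (id u, c u, t u).
(* A non-root names a neighbour as parent and identifiers are injective, so it is counted at exactly
   one node; a root is nobody's child. *)
have one_parent u : \sum_v child v u = ~~ is_root id c u.
  have /and5P[_ _ _ _ /=] := static u; rewrite -/(is_root id c u).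
  case: (boolP (is_root id c u)) => /= [ru _|ru /hasP[_ /mapP[p + ->] /= /eqP idp]].
    by rewrite big1 // => v _; rewrite /child /is_child /= -/(is_root id c u) ru !andbF.
  rewrite mem_nb => eup.
  rewrite (bigD1 p) //= big1 ?addn0 => [|v vp].
    by rewrite /child /is_child /= -/(is_root id c u) ru e_sym eup idp eqxx.
  apply/eqP; rewrite eqb0; apply: contra vp => /and3P[_ /eqP pv _].
  by apply/eqP/id_inj; rewrite idp; exact/esym.
have childE v i : \sum_(y <- [seq (id u, c u, t u) | u <- nb v] | is_child (id v, c v, t v) y) nth 0 y.2 i
    = \sum_(u | child v u) nth 0 (t u) i.
  by rewrite big_map (perm_big _ (nbE v)) big_filter_cond big_enum_cond.
pose h := pair_hash w r.
have out_total : \sum_(v | is_root id c v) nth 0 (t v) 0 =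
    \sum_v \sum_(z <- steps_of k (c v)) h (next_state z).
  apply: (children_total one_parent) => v.
  by case/and3P: (hc v) => /= /eqP -> _ _; rewrite childE.
have in_total : \sum_(v | is_root id c v) nth 0 (t v) 1 =
    \sum_v \sum_(z <- steps_of k (c v)) h z.1.
  apply: (children_total one_parent) => v.
  by case/and3P: (hc v) => /= _ /eqP -> _; rewrite childE.
rewrite !big_cat !big_map !big_filter !big_enum_cond !big_flatten !big_map /=.
rewrite -/h -out_total -in_total -!big_split /=.
apply: eq_bigr => v rv; case/and3P: (hc v) => _ _ /=.
by rewrite -/(is_root id c v) rv => /eqP.
Qed.

End Soundness.

(** * Honest certificates *)

Section Completeness.
Variables (k n : nat) (e : rel 'I_n) (id : 'I_n -> nat) (nb : 'I_n -> seq 'I_n).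
Hypotheses (k_gt0 : 0 < k) (n_gt0 : 0 < n).
Hypotheses (e_sym : symmetric e) (e_irr : irreflexive e) (e_conn : forall u v, connect e u v).
Hypothesis id_inj : injective id.
Hypothesis nbE : forall v, perm_eq (nb v) [seq u <- enum 'I_n | e v u].
Variable S : 'I_n -> seq nat.
Hypotheses (S_size : forall v, size (S v) = k) (S_sorted : forall v, sorted ltn (S v)).
Hypothesis S_perm : perm_eq (flatten [seq S v | v <- enum 'I_n]) (iota 0 (n * k)).
Hypothesis S_meets : forall u v, u != v -> e u v = meets ltn (S u) (S v).

Lemma slots_disjoint u v x : x \in S u -> x \in S v -> u = v.
Proof.
apply: (@uniq_flatten_eq _ _ S (enum 'I_n)); rewrite ?mem_enum //.
by rewrite (perm_uniq S_perm) iota_uniq.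
Qed.

Lemma slots_lt v x : x \in S v -> x < n * k.
Proof.
move=> xv; have : x \in flatten [seq S v | v <- enum 'I_n].
  by apply/flatten_mapP; exists v; rewrite ?mem_enum.
by rewrite (perm_mem S_perm) mem_iota.
Qed.

Lemma slots_numbered u x : x \in S u -> x = \sum_w count (fun y => y < x) (S w).
Proof.
move=> /slots_lt xlt; have := permP S_perm (fun y => y < x).
rewrite count_flatten_map big_enum /= => ->.
rewrite -{1}(size_iota 0 x) -(subnKC (ltnW xlt)) iotaD count_cat add0n.
rewrite (@eq_in_count _ _ predT) => [|y]; last by rewrite mem_iota => /= ->.
rewrite count_predT (@eq_in_count _ _ pred0) ?count_pred0 ?addn0 // => y.
by rewrite mem_iota => /andP[xy _]; rewrite ltnNge xy.
Qed.

Let lbl := label S.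

(** Moving the threshold past a slot can only count that slot, and it is leading exactly when
    [i == 0]. Thus honest successor states are the states of the next slot number. *)
Lemma label_next v i : i < k -> lbl (nth 0 (S v) i).+1 = lbl (nth 0 (S v) i) + (i == 0).
Proof.
move=> ik.
have -> : nat_of_bool (i == 0) = \sum_w (nth 0 (S w) 0 == nth 0 (S v) i).
  rewrite (bigD1 v) //= big1 ?addn0 => [|w wv].
    rewrite nth_uniq ?S_size //; last exact: (sorted_uniq ltn_trans ltnn).
    by rewrite eq_sym.
  apply/eqP; rewrite eqb0; apply: contra wv => /eqP E.
  apply/eqP/(@slots_disjoint w v (nth 0 (S w) 0)); first by rewrite mem_nth ?S_size.
  by rewrite E mem_nth ?S_size.
rewrite /lbl /label -big_split; apply: eq_bigr => w _ /=.
by rewrite ltnS; case: ltngtP.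
Qed.

Lemma label_le x : lbl x <= n.
Proof.
rewrite /lbl /label -[leqRHS]card_ord -sum1_card; apply: leq_sum => w _.
by case: (_ < x).
Qed.

Definition honest_steps v := steps (S v) [seq lbl x | x <- S v].

Lemma honest_states v : [seq z.1 | z <- honest_steps v] = [seq (x, lbl x) | x <- S v].
Proof.
rewrite /honest_steps /steps -map_comp -[in RHS](mkseq_nth 0 (S v)) -map_comp.
apply/eq_in_map => i; rewrite mem_iota add0n => /= ik.
by rewrite (nth_map 0).
Qed.

Lemma honest_next_states v :
  [seq next_state z | z <- honest_steps v] = [seq (x.+1, lbl x.+1) | x <- S v].
Proof.
rewrite /honest_steps /steps -map_comp -[in RHS](mkseq_nth 0 (S v)) -map_comp.
apply/eq_in_map => i; rewrite mem_iota add0n => /= ik.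
by rewrite /next_state /= (nth_map 0) // -label_next // -(S_size v).
Qed.

Lemma last_slot_owner : exists v, last 0 (S v) = (n * k).-1.
Proof.
have nk : 0 < n * k by rewrite muln_gt0 n_gt0.
have : (n * k).-1 \in flatten [seq S v | v <- enum 'I_n].
  by rewrite (perm_mem S_perm) mem_iota /= add0n prednK.
case/flatten_mapP => v _ mv; exists v.
rewrite -nth_last S_size; apply/eqP; rewrite eqn_leq; apply/andP; split.
  by rewrite -ltnS prednK //; apply: (@slots_lt v); rewrite mem_nth // S_size prednK.
case/(nthP 0): mv => i; rewrite S_size => ik <-.
apply: (sorted_leq_nth leq_trans leqnn); rewrite ?inE ?S_size ?prednK //; last by rewrite -ltnS prednK.
by have := S_sorted v; rewrite ltn_sorted_uniq_leq => /andP[].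
Qed.

Lemma honest_certificates :
  exists (c : 'I_n -> seq nat) (t : nat -> bits -> 'I_n -> seq nat),
  [/\ forall v, size (c v) = 2 * k + 2,
      forall v x, x \in c v -> x <= n * k \/ exists u, x = id u,
      forall w r v, size (t w r v) = 2,
      forall w r v x, x \in t w r v -> x <= n * (n * (k * 3)) &
      forall w r v, local_check k w r (id v, c v, t w r v)
                      [seq (id u, c u, t w r u) | u <- nb v]].
Proof.
have [root rootP] := last_slot_owner.
have [par [dist [dist_lt parP]]] := spanning_parents root e_conn.
pose c v := [:: id root; id (par v)] ++ S v ++ [seq lbl x | x <- S v].
have slotsE v : slots_of k (c v) = S v by rewrite /slots_of /= drop0 take_size_cat.
have labelsE v : labels_of k (c v) = [seq lbl x | x <- S v].
  by rewrite /labels_of /= drop0 drop_size_cat.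
have stepsE v : steps_of k (c v) = honest_steps v by rewrite /steps_of slotsE labelsE.
have is_rootE v : is_root id c v = (v == root) by rewrite /is_root /= inj_eq.
have mem_nb v u : (u \in nb v) = e v u by rewrite (perm_mem (nbE v)) mem_filter mem_enum andbT.
have static v : static_check k (id v, c v) [seq (id u, c u) | u <- nb v].
  rewrite /static_check /= !slotsE labelsE S_sorted /=; apply/and4P; split.
  - by apply/allP => _ /mapP[u _ ->].
  - apply/allP => _ /mapP[u + ->] /=; rewrite mem_nb slotsE => evu.
    by rewrite -S_meets //; apply: contraL evu => /eqP ->; rewrite e_irr.
  - have ysE := perm_map S (nbE v).
    rewrite -map_comp (eq_map (g := S)); last by move=> u; exact: slotsE.
    apply/(gap_check_balance k_gt0 e_irr S_size S_sorted slots_disjoint slots_numbered _ ysE).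
      by move=> i ik; rewrite (nth_map 0) ?S_size.
    move=> i ik; rewrite big_distrr; apply: eq_bigr => u /andP[uv nvu] /=.
    rewrite (inside_gap_nonmeeting k_gt0 S_size S_sorted slots_disjoint) //.
    by rewrite -S_meets // eq_sym.
  - rewrite (inj_eq id_inj); have [//|vr] /= := eqVneq v root.
    have [evp _] := parP v vr; apply/hasP; exists (id (par v), c (par v)) => //=.
    by apply/mapP; exists (par v); rewrite ?mem_nb.
have dist_lt' v : dist v < n by rewrite -[n]card_ord.
have dpar v : v != root -> dist (par v) < dist v by move=> /parP[].
have [sums sumsP] := subtree_sums dist_lt' dpar.
pose hash_sums w r (F : nat * nat * bool -> nat * nat) v :=
  \sum_(z <- steps_of k (c v)) pair_hash w r (F z).
pose t w r v := [:: sums (hash_sums w r next_state) v; sums (hash_sums w r fst) v].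
exists c, t; split=> // [v|v x|w r v x|w r v].
- by rewrite /= size_cat size_map S_size; lia.
- rewrite !inE mem_cat => /or4P[/eqP ->|/eqP ->|/slots_lt/ltnW|/mapP[y _ ->]]; auto.
  + by right; exists root.
  + by right; exists (par v).
  + by left; apply: leq_trans (label_le y) _; rewrite leq_pmulr.
- have bound F : sums (hash_sums w r F) v <= n * (n * (k * 3)).
    have [_ le] := sumsP (hash_sums w r F); apply: leq_trans (le v) _.
    rewrite leq_mul2l -[X in _ <= X * _]card_ord -sum_nat_const orbC leq_sum // => u _.
    have sz : size (steps_of k (c u)) = k by rewrite stepsE /steps size_map size_iota S_size.
    rewrite -[X in X * 3]sz /hash_sums.
    elim: (steps_of _ _) => [|z s IH]; first by rewrite big_nil.
    by rewrite big_cons mulSn leq_add // pair_hash_le.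
  by rewrite !inE => /orP[] /eqP ->; exact: bound.
rewrite /local_check /= -map_comp static /=.
pose h := pair_hash w r.
pose a0 := hash_sums w r next_state; pose a1 := hash_sums w r fst.
have [s0E _] := sumsP a0; have [s1E _] := sumsP a1; rewrite {}/t -/a0 -/a1.
set s0 := sums a0 in s0E *; set s1 := sums a1 in s1E *.
have childE (s : 'I_n -> nat) i : (forall u, nth 0 [:: s0 u; s1 u] i = s u) ->
   \sum_(y <- [seq (id u, c u, [:: s0 u; s1 u]) | u <- nb v] |
        is_child (id v, c v, [:: s0 v; s1 v]) y) nth 0 y.2 i
    = \sum_(u | (u != root) && (par u == v)) s u.
  move=> sE; rewrite big_map (perm_big _ (nbE v)) big_filter_cond big_enum_cond /=.
  rewrite (eq_bigr s) => [|u _]; last exact: sE.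
  apply: eq_bigl => u; rewrite /is_child /parent_of /root_of /= !(inj_eq id_inj).
  rewrite andbC -andbA andbC -andbA; have [//|ur] /= := eqVneq u root.
  have [uv|] := eqVneq (par u) v; rewrite ?andbF //=.
  by have [+ _] := parP u ur; rewrite uv e_sym => ->.
have one_parent u : \sum_v ((u != root) && (par u == v)) = ~~ (u == root).
  have [_|ur] /= := eqVneq u root; first by rewrite big1.
  rewrite (bigD1 (par u)) //= eqxx big1 // => p; rewrite eq_sym => /negPf ->.
  by [].
have total (a s : 'I_n -> nat) :
    (forall p, s p = a p + \sum_(u | (u != root) && (par u == p)) s u) ->
    s root = \sum_u a u.
  by move=> sE; rewrite -(children_total one_parent sE) big_pred1_eq.
rewrite /hash_check /= (childE s0) // (childE s1) // -/(a0 v) -/(a1 v) -s0E -s1E !eqxx /=.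
rewrite (inj_eq id_inj); apply/implyP => /eqP ->.
rewrite (total _ _ s0E) (total _ _ s1E) slotsE labelsE.
set X := [seq z.1 | z <- all_steps k c]; set X' := [seq next_state z | z <- all_steps k c].
have XE : X = [seq (x, lbl x) | x <- flatten [seq S v | v <- enum 'I_n]].
  rewrite /X /all_steps !map_flatten -!map_comp; congr flatten; apply: eq_map => u /=.
  by rewrite stepsE honest_states.
have X'E : X' = [seq (x.+1, lbl x.+1) | x <- flatten [seq S v | v <- enum 'I_n]].
  rewrite /X' /all_steps !map_flatten -!map_comp; congr flatten; apply: eq_map => u /=.
  by rewrite stepsE honest_next_states.
have finalE : final_state (S root) [seq lbl x | x <- S root] = (n * k, lbl (n * k)).
  have nk : 0 < n * k by rewrite muln_gt0 n_gt0.
  rewrite /final_state -last_map -/(honest_steps root) honest_next_states.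
  move: rootP; have := S_size root; case: (S root) => [/= k0|y s _ /=]; first by move: k_gt0; rewrite -k0.
  by rewrite last_map => ->; rewrite prednK.
(* Both sides list the states [(x, lbl x)] for [x] from 0 to [n * k]: one adds the first to all
   successors, the other adds the last to all slots. *)
have pe : perm_eq ((0, 0) :: X') ((n * k, lbl (n * k)) :: X).
  rewrite XE X'E; apply: (@perm_trans _ [seq (x, lbl x) | x <- iota 0 (n * k).+1]).
    have -> : (0, 0) = (0, lbl 0) by rewrite /lbl /label big1.
    rewrite /= perm_cons (iotaDl 1 0) -map_comp; exact: (perm_map _ S_perm).
  rewrite -addn1 iotaD map_cat perm_catC /= add0n perm_cons perm_sym.
  exact: (perm_map _ S_perm).
have : \sum_(x <- (0, 0) :: X') h x = \sum_(x <- (n * k, lbl (n * k)) :: X) h x.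
  exact: perm_big.
have flatE (F : nat * nat * bool -> nat) :
    \sum_(z <- all_steps k c) F z = \sum_v \sum_(z <- steps_of k (c v)) F z.
  by rewrite big_flatten (big_map _ xpredT) big_enum.
by rewrite !big_cons !(big_map _ xpredT) !flatE finalE => ->.
Qed.

End Completeness.

(** * The protocol *)

Section Protocol.
Variables k d : nat.

(* Identifiers, slots, labels and hash sums all fit in [width N] bits. *)
Definition width (N : nat) : nat := (trunc_log 2 (3 * k * N ^ d.+2)).+1.

Definition node_info (N i : nat) (c1 c2 : bits) : info :=
  (i, decode (width N) (2 * k + 2) c1, decode (width N) 2 c2).

Definition message_of_info (N : nat) (x : info) : bits :=
  encode (width N) (x.1.1 :: x.1.2 ++ x.2).

Definition info_of_message (N : nat) (b : bits) : info :=
  let s := decode (width N) (1 + (2 * k + 2 + 2)) b in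
  (head 0 s, take (2 * k + 2) (behead s), drop (2 * k + 2) (behead s)).

(** Decoded fields are below [2 ^ width N], but a successor state adds one, so this value itself
    must be a digit. *)
Definition hash_base (N : nat) : nat := (2 ^ width N).+1.

Definition polygon_protocol : dMAM_protocol := {|
  rlen := fun N => (hash_base N * hash_base N).*2;
  msg := fun N i _ c1 c2 => message_of_info N (node_info N i c1 c2);
  dec := fun N i r c1 c2 ms =>
    local_check k (hash_base N) r (node_info N i c1 c2)
      [seq info_of_message N b | b <- ms]
|}.

(** Nodes forward decoded fields, so the length does not depend on what Merlin sent: one identifier,
    [2 k + 2] fields and two sums. *)
Lemma size_message N i c1 c2 :
  size (message_of_info N (node_info N i c1 c2)) = (2 * k + 5) * width N.
Proof.
by rewrite size_encode [size _]/= size_cat !size_decode; congr muln; rewrite /=; lia.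
Qed.

Lemma message_of_infoK N i c1 c2 : i < 2 ^ width N ->
  info_of_message N (message_of_info N (node_info N i c1 c2)) = node_info N i c1 c2.
Proof.
move=> iN; rewrite /info_of_message /message_of_info; set s := _ :: _.
have sE : behead s = decode (width N) (2 * k + 2) c1 ++ decode (width N) 2 c2 by [].
have -> : 1 + (2 * k + 2 + 2) = size s.
  by rewrite -[size s]/(size (behead s)).+1 sE size_cat !size_decode.
rewrite encodeK => [|x].
  by rewrite sE take_size_cat ?drop_size_cat ?size_decode.
by rewrite inE mem_cat => /or3P[/eqP -> //|/decode_lt|/decode_lt].
Qed.

(** Since [3 k < 2 ^ (3 k)] and [N <= n ^ d <= 2 ^ (L d)], the largest field is below
    [2 ^ (3 k + L d (d + 2))]; this gives the constant. *)
Lemma width_bound n N : 0 < k -> N <= n ^ d ->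
  width N <= (3 * k + d.+2 * d) * (trunc_log 2 n).+1.
Proof.
move=> k0 Nn; set L := (trunc_log 2 n).+1.
have E : 3 * k * N ^ d.+2 < 2 ^ (3 * k + L * d * d.+2).
  rewrite expnD; apply: leq_ltn_trans (_ : 3 * k * 2 ^ (L * d * d.+2) < _); last first.
    by rewrite ltn_mul2r expn_gt0 ltn_expl.
  rewrite leq_mul2l (expnM 2 (L * d)) leq_exp2r // expnM (leq_trans Nn) ?orbT //.
  by case: (d) => // d'; rewrite leq_exp2r // ltnW // trunc_log_ltn.
apply: (@leq_trans (3 * k + L * d * d.+2)); last by rewrite /L; nia.
have [z|z] := posnP (3 * k * N ^ d.+2); first by rewrite /width z trunc_log0; lia.
by rewrite /width -(@ltn_exp2l 2) // (leq_ltn_trans _ E) // trunc_logP.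
Qed.

Lemma width_fits N x : x <= 3 * k * N ^ d.+2 -> x < 2 ^ width N.
Proof. by move=> xN; apply: leq_ltn_trans xN _; exact: trunc_log_ltn. Qed.

Variables (n : nat) (e : rel 'I_n) (id : 'I_n -> nat) (N : nat).
Hypotheses (k_gt0 : 0 < k) (n_gt0 : 0 < n) (n_le : n <= N).
Hypothesis id_le : forall v, id v <= n ^ d.

Lemma expn_le_fields j : j <= d.+2 -> n ^ j <= N ^ d.+2.
Proof.
move=> jd; apply: leq_trans (_ : n ^ d.+2 <= _); first by rewrite leq_pexp2l.
by rewrite leq_exp2r.
Qed.

Lemma id_fits v : id v < 2 ^ width N.
Proof.
apply: width_fits; apply: leq_trans (id_le v) _.
by apply: leq_trans (expn_le_fields _) _; rewrite ?leq_pmull ?muln_gt0 //; lia.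
Qed.

Lemma all_acceptE r c1 c2 :
  all_accept polygon_protocol e id N r c1 c2 =
  [forall v, local_check k (hash_base N) r (node_info N (id v) (c1 v) (c2 v))
     [seq node_info N (id u) (c1 u) (c2 u) | u <- neighbours_by_id e id v]].
Proof.
apply: eq_forallb => v; rewrite /= -map_comp; congr local_check.
by apply: eq_map => u; rewrite /= message_of_infoK // id_fits.
Qed.

Lemma perm_neighbours v :
  perm_eq (neighbours_by_id e id v) [seq u <- enum 'I_n | e v u].
Proof. by rewrite /neighbours_by_id perm_sort. Qed.

Hypotheses (e_sym : symmetric e) (e_irr : irreflexive e) (e_conn : forall u v, connect e u v).
Hypothesis id_inj : injective id.

Lemma polygon_complete : 1 < k -> k_polygon_circle k e ->
  exists (c1 : 'I_n -> bits) (c2 : bits -> 'I_n -> bits),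
  [/\ forall v, size (c1 v) <= (2 * k + 5) * width N,
      forall r v, size (c2 r v) <= (2 * k + 5) * width N &
      forall r, all_accept polygon_protocol e id N r c1 (c2 r)].
Proof.
move=> k1 /(polygon_slots k1)[S [S_size S_sorted S_perm S_meets]].
have [c [t [c_size c_le t_size t_le ok]]] := honest_certificates k_gt0 n_gt0
  e_sym e_irr e_conn id_inj perm_neighbours S_size S_sorted S_perm S_meets.
have c_fits v : {in c v, forall x, x < 2 ^ width N}.
  move=> x /c_le[xle|[u ->]]; last exact: id_fits.
  apply: width_fits; apply: leq_trans xle _.
  by have := @expn_le_fields 1 isT; rewrite expn1; nia.
have t_fits w r v : {in t w r v, forall x, x < 2 ^ width N}.
  move=> x /t_le xle; apply: width_fits; apply: leq_trans xle _.
  have := @expn_le_fields 2 isT; rewrite -mulnn mulnA => le.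
  by rewrite [3 * k]mulnC mulnC leq_mul2l le orbT.
exists (fun v => encode (width N) (c v)), (fun r v => encode (width N) (t (hash_base N) r v)).
split=> [v|r v|r].
- by rewrite size_encode c_size leq_mul2r; apply/orP; right; lia.
- by rewrite size_encode t_size leq_mul2r; apply/orP; right; lia.
rewrite all_acceptE; apply/forallP => v.
have infoE u : node_info N (id u) (encode (width N) (c u)) (encode (width N) (t (hash_base N) r u))
    = (id u, c u, t (hash_base N) r u).
  by rewrite /node_info -(c_size u) -(t_size (hash_base N) r u) !encodeK.
by rewrite infoE (eq_map infoE); exact: ok.
Qed.

Lemma states_bounded (c : 'I_n -> seq nat) M : 0 < M ->
  (forall v x, x \in c v -> x < M) ->
  {in left_states k id c ++ right_states k id c, forall x, x.1 < M.+1 /\ x.2 < M.+1}.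
Proof.
move=> M0 cM.
have nthM s i : {subset s <= [pred x | x < M]} -> nth 0 s i < M.
  by move=> sM; case: (ltnP i (size s)) => [/(mem_nth 0)/sM|/(nth_default 0) ->].
have slotsM v : {subset slots_of k (c v) <= [pred x | x < M]}.
  by move=> x /mem_take/mem_drop/cM.
have labelsM v : {subset labels_of k (c v) <= [pred x | x < M]}.
  by move=> x /mem_drop/mem_drop/cM.
have stepM v z : z \in steps_of k (c v) -> z.1.1 < M /\ z.1.2 < M.
  by case/mapP => i _ -> /=; split; apply: nthM; [exact: slotsM|exact: labelsM].
have allM z : z \in all_steps k c -> z.1.1 < M /\ z.1.2 < M.
  by case/flatten_mapP => v _; exact: stepM.
have nextM (z : nat * nat * bool) : z.1.1 < M /\ z.1.2 < M ->
    (next_state z).1 < M.+1 /\ (next_state z).2 < M.+1.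
  by case: z => [[p l] b] /= [pM lM]; case: b; lia.
move=> x; rewrite !mem_cat => /orP[/orP[]|/orP[]] /mapP[z zin ->].
- by [].
- exact: nextM (allM z zin).
- apply: nextM; have := mem_last (0, 0, false) (steps_of k (c z)).
  by rewrite inE => /orP[/eqP ->|/stepM].
- by have [? ?] := allM z zin; split; apply: ltnW.
Qed.

(** The first certificates fix both multisets in advance. If they agree and some string is accepted,
    the slots realise the graph; if they differ, every accepted string is a hash collision. *)
Lemma polygon_sound (c1 : 'I_n -> bits) (c2 : bits -> 'I_n -> bits) :
  ~ k_polygon_circle k e ->
  4 * n_accepting polygon_protocol e id N c1 c2 <= 2 ^ rlen polygon_protocol N.
Proof.
move=> npoly; rewrite /n_accepting; set A := [set r | _].
have [->|[r0 r0A]] := set_0Vmem A; first by rewrite cards0.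
pose c v := decode (width N) (2 * k + 2) (c1 v).
have c_size v : size (c v) = 2 * k + 2 by exact: size_decode.
have checks r : r \in A -> forall v,
    local_check k (hash_base N) (val r) (id v, c v, decode (width N) 2 (c2 (val r) v))
      [seq (id u, c u, decode (width N) 2 (c2 (val r) u)) | u <- neighbours_by_id e id v].
  by rewrite inE all_acceptE => /forallP.
have static v : static_check k (id v, c v) [seq (id u, c u) | u <- neighbours_by_id e id v].
  by have /andP[+ _] := checks r0 r0A v; rewrite -map_comp.
have [pe|npe] := boolP (perm_eq (left_states k id c) (right_states k id c)).
  case: npoly; exact: (sound_states k_gt0 n_gt0 e_sym e_irr e_conn id_inj perm_neighbours c_size static pe).
have bounded : {in left_states k id c ++ right_states k id c, forall x,
    x.1 < hash_base N /\ x.2 < hash_base N}.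
  apply: states_bounded; rewrite ?expn_gt0 // => v x; exact: decode_lt.
apply: leq_trans (hash_collisions bounded npe); rewrite leq_mul2l; apply/orP; right.
apply/subset_leq_card/subsetP => r rA; rewrite inE; apply/eqP.
pose t v := decode (width N) 2 (c2 (val r) v).
apply: (sound_hash e_sym id_inj perm_neighbours static (t := t)) => v.
by have /andP[_] := checks r rA v.
Qed.

End Protocol.

(* In [valid_ids] the symbol [^] was parsed as [Nat.pow]. *)
Lemma pow_expn m j : Nat.pow m j = m ^ j.
Proof. by elim: j => //= j ->; rewrite expnS multE. Qed.

Theorem theorem4 :
  forall k : nat, 2 <= k ->
  forall d : nat, 1 <= d ->
  exists (C : nat) (P : dMAM_protocol),
  forall (n : nat) (e : rel 'I_n) (id : 'I_n -> nat) (N : nat),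
    0 < n -> simple_connected e -> valid_ids d id -> n <= N <= n ^ d ->
    let B := C * (trunc_log 2 n).+1 in
    (* messages have O(log n) bits *)
    (forall (r : bits) (c1 c2 : 'I_n -> bits) (v : 'I_n),
        certs_bounded B c1 -> certs_bounded B c2 ->
        size (msg P N (id v) r (c1 v) (c2 v)) <= B) /\
    (* completeness *)
    (k_polygon_circle k e ->
       exists c1 : 'I_n -> bits, certs_bounded B c1 /\
       exists c2 : bits -> 'I_n -> bits,
         (forall r, certs_bounded B (c2 r)) /\
         2 * 2 ^ rlen P N <= 3 * n_accepting P e id N c1 c2) /\
    (* soundness *)
    (~ k_polygon_circle k e ->
       forall (c1 : 'I_n -> bits) (c2 : bits -> 'I_n -> bits),
         certs_bounded B c1 -> (forall r, certs_bounded B (c2 r)) ->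
         2 * 2 ^ rlen P N <= 3 * (2 ^ rlen P N - n_accepting P e id N c1 c2)).
Proof.
move=> k k_gt1 d d_gt0; have k_gt0 := ltnW k_gt1.
exists ((2 * k + 5) * (3 * k + d.+2 * d)), (polygon_protocol k d).
move=> n e id N n_gt0 [e_sym [e_irr e_conn]] [id_inj id_bounds] /andP[n_le N_le] B.
have id_le v : id v <= n ^ d by rewrite -pow_expn; have /andP[] := id_bounds v.
have wB : (2 * k + 5) * width k d N <= B.
  by rewrite /B -mulnA leq_mul2l width_bound ?orbT.
split=> [r c1 c2 v _ _|]; first by rewrite size_message.
split=> [poly|npoly c1 c2 _ _].
  have [c1 [c2 [c1B c2B acc]]] := polygon_complete k_gt0 n_gt0 n_le id_le
    e_sym e_irr e_conn id_inj k_gt1 poly.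
  exists c1; split=> [v|]; first exact: leq_trans (c1B v) wB.
  exists c2; split=> [r v|]; first exact: leq_trans (c2B r v) wB.
  rewrite /n_accepting; set A := [set r | _].
  have -> : A = setT by apply/setP => r; rewrite !inE acc.
  by rewrite cardsT card_tuple card_bool leq_mul.
have := polygon_sound k_gt0 n_gt0 n_le id_le e_sym e_irr e_conn id_inj c1 c2 npoly.
by move: (n_accepting _ _ _ _ _ _) (2 ^ _) => a b; lia.
Qed.
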